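(* Let $X$ be a smooth projective curve over $\mathbb{C}$, let $v=(\alpha_1,\dots,\alpha_n)_{\mathfrak{S}_n}\in\mathrm{V}^{\mathrm{nod}}$, let $D$ be the set of nodes of $\overline{X}_v$ and $R\subset D$ a subdivisor. Suppose that the multidegree $\overline d=(d_i^k)$ (with $i=1,\dots,n_R$, $k=1,\dots,|C_i|$) satisfies $$\sum_{k=1}^{|C_i|}d_i^k=|D_i|\qquad\text{for all }i=1,\dots,n_R.$$ Then: (1) Assume $R_s\ne\emptyset$. The Higgs bundles corresponding to spectral data in $\check\nu_R(\mathrm{Jac}^{\overline d}(\widetilde{X}_R))$ admit a reduction of their structure group to $\mathrm{B}_1\times\dots\times\mathrm{B}_{n_R}\subset\mathrm{B}$, where $\mathrm{B}_i$ is the Borel subgroup of $\mathrm{GL}(|C_i|,\mathbb{C})$. (2) Consider a Higgs bundle $(E,\varphi)=\bigoplus_{k=1}^{n_R}(E_k,\varphi_k)$ in $h^{-1}(v)\cap\check\nu_R(\mathrm{Jac}^{\overline d}(\widetilde{X}_R))$, with spectral datum $\nu_{R,*}L$, where $L$ is a line bundle over $\widetilde{X}_R$. Then, for all $k\in\{1,\dots,n_R\}$ and any ordering $J_k=(\alpha_{j_1},\dots,\alpha_{j_{|C_k|}})$ of $C_k$, one can choose canonically a filtration $$0\subsetneq(E_{k,1},\varphi_{k,1})\subsetneq\dots\subsetneq(E_{k,|C_k|},\varphi_{k,|C_k|})=(E_k,\varphi_k)$$ such that $$(E_{k,i},\varphi_{k,i})/(E_{k,i-1},\varphi_{k,i-1})\cong\Big(L|_{\widetilde{X}_{j_i}}\otimes\mathcal{O}\Big(-\sum_{i'\ge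 i+1}\widetilde{X}_{j_i}\cap\widetilde{X}_{j_{i'}}\Big),\ \alpha_{j_i}\Big),$$ where bundles and divisors on $\widetilde{X}_{j_i}$ are identified with bundles and divisors on $X$ through the isomorphism $\widetilde{X}_{j_i}\cong X$ induced by the projection to $X$.
   Context: $K$ is the canonical bundle of $X$ and $g$ its genus. $\mathrm{M}_n$ is the moduli space of semistable Higgs bundles $(E,\varphi)$, $\varphi\in H^0(X,\mathrm{End}(E)\otimes K)$, of rank $n$ and degree $0$, and $h:\mathrm{M}_n\to\mathrm{H}=\bigoplus_{i=1}^nH^0(X,K^i)$ is the Hitchin map. Let $\pi:|K|\to X$ be the total space of $K$ with tautological section $\lambda$ of $\pi^*K$; the spectral curve $\overline{X}_b$ of $b\in\mathrm{H}$ is the zero locus of $\lambda^n+\pi^*b_1\lambda^{n-1}+\dots+\pi^*b_n$. Put $\delta=n(n-1)(g-1)$. The spectral correspondence identifies $h^{-1}(b)$ with the moduli space $\overline{\mathrm{Jac}}^{\,\delta}(\overline{X}_b)$ of semistable torsion-free rank one sheaves $\mathcal{F}$ (spectral data) of degree $\delta$ on $\overline{X}_b$ via $E=\pi_*\mathcal{F}$, $\varphi$ being induced by multiplication by $\lambda$. $\mathrm{V}=\mathrm{Sym}^n(H^0(X,K))\subset\mathrm{H}$ via the coefficients of $\prod_i(\lambda-\alpha_i)$. If the $\alpha_i$ are distinct, $\overline{X}_v=\bigcup_jX_j$ with $X_j=\alpha_j(X)\cong X$; set $D_{jk}=X_j\cap X_k$. $\mathrm{V}^{\mathrm{nod}}$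 is the set of $v\in\mathrm{V}$ with distinct $\alpha_j$ such that no $D_{jk}$ ($j\neq k$) has a multiple point and $D_{ij}\cap D_{ik}=\emptyset$ for distinct $i,j,k$. Then $\overline{X}_v$ is nodal with set of nodes $D=\bigcup_{j<k}D_{jk}$, $|D|=\delta$. For $R\subset D$, $\nu_R:\widetilde{X}_R\to\overline{X}_v$ is the partial normalization at the nodes in $R$, with connected components $\widetilde{X}_{R,1},\dots,\widetilde{X}_{R,n_R}$. The irreducible components of $\widetilde{X}_R$ are denoted $\widetilde{X}_j\cong X_j\cong X$, $j=1,\dots,n$, and $C_i\subset\{1,\dots,n\}$ is the index set of the irreducible components of $\widetilde{X}_{R,i}$ (an ordering of $C_k$ is written as an ordering of $\{\alpha_j:j\in C_k\}$). Decompose $R=R_1\sqcup\dots\sqcup R_{n_R}\sqcup R_s$, where $R_i$ consists of the points of $R$ at which two components with indices in $C_i$ meet and $R_s$ (the separating part) of the points of $R$ at which components belonging to different connected components of $\widetilde{X}_R$ meet. $D_i$ is the singular divisor (set of nodes) of $\widetilde{X}_{R,i}$, identified with $\sum_{j<k;\,j,k\in C_i}D_{jk}-R_i\subset D$. $\mathrm{Jac}^{\overline d}(\widetilde{X}_R)=\prod_i\mathrm{Jac}^{(d_i^1,\dots,d_i^{|C_i|})}(\widetilde{X}_{R,i})$ parametrizes line bundles with multidegree $(d_i^1,\dots,d_i^{|C_i|})$ on the irreducible components of $\widetilde{X}_{R,i}$, and $\check\nu_R:\mathrm{Jac}^{\overline d}(\widetilde{X}_R)\to\overline{\mathrm{Jac}}^{\,\delta}(\overline{X}_v)\cong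 h^{-1}(v)$ is $L\mapsto\nu_{R,*}L$. In (2), $(E_k,\varphi_k)$ is the summand with spectral datum the push-forward of $L|_{\widetilde{X}_{R,k}}$. $\mathrm{B}$ is a Borel subgroup of $\mathrm{GL}(n,\mathbb{C})$. *)

(* Defs.v *)
(* Algebraic varieties over C = R[i] are handled in the style of Serre: a
   topological space together with its germs of regular (C-valued) functions.
   All curves that occur here are reduced, so nothing is lost.  Coherent sheaves,
   line bundles and Higgs bundles are sheaves of modules. *)
From HB Require Import structures.
From mathcomp Require Import all_boot all_order all_algebra.
From mathcomp Require Import finmap complex.
From mathcomp Require Import boolp classical_sets functions cardinality.
From mathcomp Require Import reals topology.
From mathcomp Require Import -(notations) mpoly.

Set Implicit Arguments.
Unset Strict Implicit.
Unset Printing Implicit Defensive.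

Import Order.TTheory GRing.Theory Num.Theory.
Local Open Scope classical_set_scope.
Local Open Scope ring_scope.

(* [reg x f]: the germ at x of the function f is regular. *)
Record space (R : realType) := Space {
  space_top :> topologicalType;
  reg : space_top -> (space_top -> R[i]) -> Prop }.

Definition regular (R : realType) (Y : space R) (U : set Y) (f : Y -> R[i]) :=
  forall y, U y -> reg y f.

(* Closed or open subvarieties: induced topology; a function is regular if it is
   locally the restriction of a regular function of the ambient space. *)
Section Subspace.
Variables (R : realType) (Y : space R) (Z : set Y).

Definition sub_pt := {y : Y | `[< Z y >]}.
Definition sub_incl (z : sub_pt) : Y := val z.
Definition sub_top : topologicalType := initial_topology sub_incl.

Lemma sub_inclP (z : sub_pt) : Z (sub_incl z).
Proof. by apply/asboolP; exact: (valP z). Qed.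

Definition sub_mk (y : Y) (hy : Z y) : sub_pt := exist _ y (asboolT hy).

Definition subspace : space R := @Space R sub_top
  (fun z f => exists2 g, reg (sub_incl z) g & \forall z' \near z, f z' = g (sub_incl z')).
End Subspace.

Record morphism (R : realType) (Z Y : space R) := Morphism {
  mor :> Z -> Y;
  mor_cont : continuous mor;
  mor_reg : forall z f, reg (mor z) f -> reg z (f \o mor) }.

Section Projective.
Variables (R : realType) (N : nat).
Local Notation C := (R[i]).

(* A point of P^N is represented by its unique vector of homogeneous coordinates
   whose first nonzero coordinate is 1. *)
Definition normalized (x : 'rV[C]_N.+1) : bool :=
  [exists i, (x 0 i == 1) && [forall j : 'I_N.+1, (j < i)%N ==> (x 0 j == 0)]].

Definition proj_pt := {x : 'rV[C]_N.+1 | normalized x}.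
HB.instance Definition _ := Choice.on proj_pt.

Definition pval (P : mpoly N.+1 C) (x : proj_pt) : C :=
  meval (fun i => val x 0 i) P.

Definition homog (d : nat) (P : mpoly N.+1 C) : bool :=
  P \is ishomog1 d mdeg.

Definition proj_open (U : set proj_pt) := forall x, U x -> exists d Q,
  [/\ homog d Q, pval Q x != 0 & forall y, pval Q y != 0 -> U y].

Lemma homogM d e P Q : homog d P -> homog e Q -> homog (d + e) (P * Q).
Proof. exact: dhomogM. Qed.

Lemma pvalM P Q x : pval (P * Q) x = pval P x * pval Q x.
Proof. exact: mevalM. Qed.

Lemma proj_openT : proj_open setT.
Proof.
move=> x _; exists 0%N, 1; split=> //; first exact: dhomog1.
by rewrite /pval meval1 oner_eq0.
Qed.

Lemma proj_openI : setI_closed proj_open.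
Proof.
move=> A B hA hB x [Ax Bx].
have [d [P [hP Px PA]]] := hA x Ax; have [e [Q [hQ Qx QB]]] := hB x Bx.
exists (d + e)%N, (P * Q); split; first exact: homogM.
  by rewrite pvalM mulf_neq0.
by move=> y; rewrite pvalM mulf_eq0 negb_or => /andP[/PA ? /QB ?].
Qed.

Lemma proj_open_bigU (I : Type) (F : I -> set proj_pt) :
  (forall i, proj_open (F i)) -> proj_open (\bigcup_i F i).
Proof.
move=> hF x [i _ /hF[d [Q [hQ Qx QF]]]]; exists d, Q; split=> // y /QF Fy.
by exists i.
Qed.

HB.instance Definition _ :=
  isOpenTopological.Build proj_pt proj_openT proj_openI proj_open_bigU.

Definition proj : space R := @Space R proj_pt (fun x f => exists d P Q,
  [/\ homog d P, homog d Q, pval Q x != 0 &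
      \forall y \near x, f y = pval P y / pval Q y]).
End Projective.

(* A function generating the maximal ideal of the local ring at p. *)
Definition uniformizer (R : realType) (Y : space R) (p : Y) (t : Y -> R[i]) :=
  [/\ reg p t, t p = 0 & forall f, reg p f -> f p = 0 ->
      exists2 g, reg p g & \forall y \near p, f y = t y * g y].

(* Infinite with finite proper closed subsets: irreducible of dimension 1.
   Then smooth at p means that the maximal ideal at p is principal. *)
Record curve (R : realType) := Curve {
  cdim : nat;
  ceqs : set (mpoly cdim.+1 R[i]);
  ceqs_homog : forall P, ceqs P -> exists d, homog d P;
  curve_space :> space R :=
    subspace [set x : proj R cdim | forall P, ceqs P -> pval P x = 0];
  curve_infinite : infinite_set [set: curve_space];
  curve_dim1 : forall Z : set curve_space, closed Z -> Z <> setT -> finite_set Z;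
  curve_smooth : forall p : curve_space, exists t, uniformizer p t }.

(* The regular germs form local C-algebras. *)
Record alg_germs (R : realType) (Y : space R) : Prop := AlgGerms {
  ag_germ : forall (x : Y) f g, (\forall y \near x, f y = g y) -> reg x f -> reg x g;
  ag_cst : forall (x : Y) c, reg x (fun=> c);
  ag_add : forall (x : Y) f g, reg x f -> reg x g -> reg x (fun y => f y + g y);
  ag_mul : forall (x : Y) f g, reg x f -> reg x g -> reg x (fun y => f y * g y);
  ag_inv : forall (x : Y) f, reg x f -> f x != 0 -> reg x (fun y => (f y)^-1);
  ag_near : forall (x : Y) f, reg x f -> f x != 0 -> \forall y \near x, f y != 0;
  ag_open : forall (x : Y) f, reg x f -> \forall y \near x, reg y f }.

Section AlgGerms.
Variable R : realType.

Lemma near_here (T : topologicalType) (x : T) (P : T -> Prop) :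
  (\forall y \near x, P y) -> P x.
Proof. by move=> h; apply: nbhs_singleton h. Qed.

Lemma homogZ N d (c : R[i]) (P : mpoly N.+1 R[i]) : homog d P -> homog d (c *: P).
Proof. exact: dhomogZ. Qed.

Lemma proj_nonzero N (x : proj R N) d Q : homog d Q -> pval Q x != 0 ->
  \forall y \near x, pval Q y != 0.
Proof.
move=> hQ Qx; apply: open_nbhs_nbhs; split=> //.
by move=> y Qy; exists d, Q; split.
Qed.

Lemma proj_alg_germs N : alg_germs (proj R N).
Proof.
split.
- move=> x f g fg [d [P [Q [hP hQ Qx fE]]]]; exists d, P, Q; split=> //.
  by apply: filterS2 fg fE => y -> ->.
- move=> x c; exists 0%N, (c *: 1), 1.
  have h1 : homog 0 (1 : mpoly N.+1 R[i]) by exact: dhomog1.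
  split=> //; [exact: homogZ|by rewrite /pval meval1 oner_eq0|].
  by apply: (filterE (F := nbhs x)) => y; rewrite /pval mevalZ meval1 mulr1 divr1.
- move=> x f g [d [P [Q [hP hQ Qx fE]]]] [e [S [T [hS hT Tx gE]]]].
  exists (d + e)%N, (P * T + Q * S), (Q * T); split=> //.
  + by apply: dhomogD; exact: homogM.
  + exact: homogM.
  + by rewrite pvalM mulf_neq0.
  + have Qn := proj_nonzero hQ Qx; have Tn := proj_nonzero hT Tx.
    apply: filterS2 (filterI fE gE) (filterI Qn Tn) => y [-> ->] [Qy Ty].
    rewrite pvalM addf_div //.
    by congr (_ / _); rewrite /pval mevalD !mevalM; congr (_ + _); rewrite mulrC.
- move=> x f g [d [P [Q [hP hQ Qx fE]]]] [e [S [T [hS hT Tx gE]]]].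
  exists (d + e)%N, (P * S), (Q * T); split=> //; try exact: homogM.
  + by rewrite pvalM mulf_neq0.
  + by apply: filterS2 fE gE => y -> ->; rewrite mulf_div !pvalM.
- move=> x f [d [P [Q [hP hQ Qx fE]]]] fx.
  exists d, Q, P; split=> //.
  + by move: fx; rewrite (near_here fE) mulf_eq0 negb_or => /andP[].
  + by apply: filterS fE => y ->; rewrite invf_div.
- move=> x f [d [P [Q [hP hQ Qx fE]]]] fx.
  have Px : pval P x != 0.
    by move: fx; rewrite (near_here fE) mulf_eq0 negb_or => /andP[].
  have Qn := proj_nonzero hQ Qx; have Pn := proj_nonzero hP Px.
  apply: filterS2 fE (filterI Qn Pn) => y -> [Qy Py].
  by rewrite mulf_neq0 ?invr_eq0.
- move=> x f [d [P [Q [hP hQ Qx fE]]]]; have Qn := proj_nonzero hQ Qx.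
  apply: filterS2 (nbhs_interior fE) Qn => y fEy Qy.
  by exists d, P, Q; split.
Qed.

Lemma near_sub (Y : space R) (Z : set Y) (z : subspace Z) (P : Y -> Prop) :
  (\forall y \near sub_incl z, P y) -> \forall z' \near z, P (sub_incl z').
Proof. exact: (@initial_continuous _ _ (@sub_incl R Y Z) z). Qed.

Lemma sub_alg_germs (Y : space R) (Z : set Y) : alg_germs Y -> alg_germs (subspace Z).
Proof.
move=> aY; split.
- move=> x f g fg [f' f'x fE]; exists f' => //.
  by apply: filterS2 fg fE => y <-.
- by move=> x c; exists (fun=> c); [exact: ag_cst|exact: (filterE (F := nbhs x))].
- move=> x f g [f' f'x fE] [g' g'x gE].
  exists (fun y => f' y + g' y); first exact: ag_add.
  by apply: filterS2 fE gE => y -> ->.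
- move=> x f g [f' f'x fE] [g' g'x gE].
  exists (fun y => f' y * g' y); first exact: ag_mul.
  by apply: filterS2 fE gE => y -> ->.
- move=> x f [f' f'x fE] fx; exists (fun y => (f' y)^-1).
    by apply: ag_inv => //; rewrite -(near_here fE).
  by apply: filterS fE => y ->.
- move=> x f [f' f'x fE] fx.
  have : \forall y \near sub_incl x, f' y != 0.
    by apply: ag_near => //; rewrite -(near_here fE).
  by move=> /near_sub f'n; apply: filterS2 f'n fE => y ? ->.
- move=> x f [f' f'x fE].
  have f'n := near_sub (ag_open aY f'x).
  by apply: filterS2 (nbhs_interior fE) f'n => y fEy f'y; exists f'.
Qed.

Lemma curve_alg_germs (X : curve R) : alg_germs X.
Proof. exact: sub_alg_germs (proj_alg_germs _). Qed.
End AlgGerms.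

Record opens (T : topologicalType) := Opens { ocar :> set T; ocarP : open ocar }.
Definition omem (T : topologicalType) (U : opens T) : T -> Prop := ocar U.
Coercion omem : opens >-> Funclass.

Definition otop (T : topologicalType) : opens T := Opens (@openT T).
Definition omeet (T : topologicalType) (U V : opens T) : opens T :=
  Opens (openI (ocarP U) (ocarP V)).

Lemma opre_subproof (R : realType) (Z Y : space R) (f : morphism Z Y) (U : opens Y) :
  open (f @^-1` U).
Proof. by apply: open_comp (ocarP U) => z _; exact: mor_cont. Qed.

Definition opre (R : realType) (Z Y : space R) (f : morphism Z Y) (U : opens Y) : opens Z :=
  Opens (opre_subproof f U).

(* Scalars are total functions of which only the restriction to U matters; the
   module laws are required for functions that are regular on U. *)
Record sheaf (R : realType) (Y : space R) := Sheaf {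
  sec :> opens Y -> zmodType;
  act : forall U : opens Y, (Y -> R[i]) -> sec U -> sec U;
  res : forall U V : opens Y, V `<=` U -> sec U -> sec V;
  act_ext : forall (U : opens Y) f g s, (forall y, U y -> f y = g y) ->
    @act U f s = act g s;
  actDr : forall (U : opens Y) f s t, regular U f -> @act U f (s + t) = act f s + act f t;
  actDl : forall (U : opens Y) f g s, regular U f -> regular U g ->
    @act U (fun x => f x + g x) s = act f s + act g s;
  actM : forall (U : opens Y) f g s, regular U f -> regular U g ->
    @act U (fun x => f x * g x) s = act f (act g s);
  act1 : forall (U : opens Y) s, @act U (fun=> 1) s = s;
  resD : forall (U V : opens Y) (h : V `<=` U) s t, res h (s + t) = res h s + res h t;
  res_act : forall (U V : opens Y) (h : V `<=` U) f s, regular U f ->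
    res h (act f s) = act f (res h s);
  res_id : forall (U : opens Y) (h : U `<=` U) s, res h s = s;
  res_comp : forall (U V W : opens Y) (h : V `<=` U) (k : W `<=` V) (l : W `<=` U) s,
    res k (res h s) = res l s;
  sheaf_glue : forall (U : opens Y) (I : Type) (V : I -> opens Y) (h : forall i, V i `<=` U)
    (s : forall i, sec (V i)), U `<=` \bigcup_i V i ->
    (forall i j (W : opens Y) (hi : W `<=` V i) (hj : W `<=` V j),
       res hi (s i) = res hj (s j)) ->
    exists! t : sec U, forall i, res (h i) t = s i }.

Arguments act {R Y} _ {U}.
Arguments res {R Y} _ {U V}.

Record hom (R : realType) (Y : space R) (E F : sheaf Y) := Hom {
  hom_fun :> forall U, E U -> F U;
  homD : forall U s t, @hom_fun U (s + t) = hom_fun s + hom_fun t;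
  hom_act : forall (U : opens Y) f s, regular U f ->
    @hom_fun U (act E f s) = act F f (hom_fun s);
  hom_res : forall (U V : opens Y) (h : V `<=` U) s,
    hom_fun (res E h s) = res F h (hom_fun s) }.

Definition hom_inj (R : realType) (Y : space R) (E F : sheaf Y) (h : hom E F) :=
  forall U, injective (@hom_fun _ _ _ _ h U).
Definition hom_iso (R : realType) (Y : space R) (E F : sheaf Y) (h : hom E F) :=
  forall U, bijective (@hom_fun _ _ _ _ h U).
(* surjectivity as a homomorphism of sheaves *)
Definition hom_surj (R : realType) (Y : space R) (E F : sheaf Y) (h : hom E F) :=
  forall U (t : F U) x, U x -> exists (V : opens Y) (VU : V `<=` U),
    V x /\ exists s : E V, h V s = res F VU t.

Section LocallyFree.
Variables (R : realType) (Y : space R) (E : sheaf Y).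

Definition lincomb (r : nat) (U V : opens Y) (VU : V `<=` U) (f : 'I_r -> Y -> R[i])
  (e : 'I_r -> E U) : E V := \sum_i act E (f i) (res E VU (e i)).

Definition frame (r : nat) (U : opens Y) (e : 'I_r -> E U) :=
  forall (V : opens Y) (VU : V `<=` U) (s : E V), exists f : 'I_r -> Y -> R[i],
    [/\ forall i, regular V (f i), s = lincomb VU f e
      & forall g, (forall i, regular V (g i)) -> s = lincomb VU g e ->
          forall i y, V y -> g i y = f i y].

Definition frame1 (U : opens Y) (e : E U) := frame (fun _ : 'I_1 => e).

Definition locally_free (r : nat) :=
  forall y, exists U : opens Y, U y /\ exists e : 'I_r -> E U, frame e.
End LocallyFree.

Section Pushforward.
Variables (R : realType) (Z Y : space R) (f : morphism Z Y) (L : sheaf Z).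

Let psec (U : opens Y) : zmodType := L (opre f U).
Let pact (U : opens Y) (g : Y -> R[i]) (s : psec U) : psec U := act L (g \o f) s.
Let pres_sub (U V : opens Y) (h : V `<=` U) : opre f V `<=` opre f U.
Proof. by move=> z; exact: h. Qed.
Let pres (U V : opens Y) (h : V `<=` U) (s : psec U) : psec V :=
  res L (pres_sub h) s.
Let preg (U : opens Y) (g : Y -> R[i]) : regular U g -> regular (opre f U) (g \o f).
Proof. by move=> hg z Uz; apply: mor_reg; exact: hg. Qed.

Definition pushforward : sheaf Y.
Proof.
refine (@Sheaf R Y psec pact pres _ _ _ _ _ _ _ _ _ _).
- move=> U g g' s gg'; apply: act_ext => z Uz; exact: gg'.
- by move=> U g s t /preg; exact: actDr.
- by move=> U g g' s /preg hg /preg; exact: actDl.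
- by move=> U g g' s /preg hg /preg; exact: actM.
- by move=> U s; exact: act1.
- by move=> *; exact: resD.
- by move=> U V h g s /preg; exact: res_act.
- by move=> *; exact: res_id.
- by move=> *; exact: res_comp.
- move=> U I V h s cov comp.
  apply: (@sheaf_glue R Z L (opre f U) I (fun i => opre f (V i)) _ s).
    by move=> z /cov[i _ Vi]; exists i.
  move=> i j W hi hj.
  have hW : W `<=` opre f (omeet (V i) (V j)) by move=> z Wz; split; [exact: hi|exact: hj].
  have hl : opre f (omeet (V i) (V j)) `<=` opre f (V i) by move=> z [].
  have hr : opre f (omeet (V i) (V j)) `<=` opre f (V j) by move=> z [].
  rewrite -(res_comp hl hW) -(res_comp hr hW); congr (res L hW _).
  have hl' : omeet (V i) (V j) `<=` V i by move=> z [].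
  have hr' : omeet (V i) (V j) `<=` V j by move=> z [].
  have := comp i j _ hl' hr'; rewrite /pres.
  by rewrite (Prop_irrelevance (pres_sub hl') hl) (Prop_irrelevance (pres_sub hr') hr).
Defined.
End Pushforward.

(* Pull-back of a locally free sheaf: a homomorphism L -> f_* N taking local frames
   of L to local frames of N. *)
Record pullback (R : realType) (Z Y : space R) (f : morphism Z Y) (L : sheaf Y)
    (N : sheaf Z) := Pullback {
  pb_hom :> hom L (pushforward f N);
  pb_frame : forall r (U : opens Y) (e : 'I_r -> L U), frame e ->
    frame (fun i => pb_hom U (e i) : N (opre f U)) }.

(* j_* j^* L for the inclusion j of an open subset O. *)
Section RestrictOpen.
Variables (R : realType) (Y : space R) (L : sheaf Y) (O : opens Y).

Let rsec (U : opens Y) : zmodType := L (omeet U O).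
Let ract (U : opens Y) (g : Y -> R[i]) (s : rsec U) : rsec U := act L g s.
Let rres_sub (U V : opens Y) (h : V `<=` U) : omeet V O `<=` omeet U O.
Proof. by move=> z [/h]. Qed.
Let rres (U V : opens Y) (h : V `<=` U) (s : rsec U) : rsec V := res L (rres_sub h) s.
Let rreg (U : opens Y) (g : Y -> R[i]) : regular U g -> regular (omeet U O) g.
Proof. by move=> hg y [Uy _]; exact: hg. Qed.

Definition restrict_open : sheaf Y.
Proof.
refine (@Sheaf R Y rsec ract rres _ _ _ _ _ _ _ _ _ _).
- by move=> U g g' s gg'; apply: act_ext => z [Uz _]; exact: gg'.
- by move=> U g s t /rreg; exact: actDr.
- by move=> U g g' s /rreg hg /rreg; exact: actDl.
- by move=> U g g' s /rreg hg /rreg; exact: actM.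
- by move=> U s; exact: act1.
- by move=> *; exact: resD.
- by move=> U V h g s /rreg; exact: res_act.
- by move=> *; exact: res_id.
- by move=> *; exact: res_comp.
- move=> U I V h s cov comp.
  apply: (@sheaf_glue R Y L (omeet U O) I (fun i => omeet (V i) O) _ s).
    by move=> z [/cov[i _ Vi] Oz]; exists i.
  move=> i j W hi hj.
  have hi' : W `<=` V i by move=> z /hi[].
  have hj' : W `<=` V j by move=> z /hj[].
  have hW : W `<=` omeet W O by move=> z Wz; split=> //; have [] := hi z Wz.
  rewrite -(res_comp (rres_sub hi') hW) -(res_comp (rres_sub hj') hW).
  by congr (res L hW _); exact: comp.
Defined.
End RestrictOpen.

Record subsheaf (R : realType) (Y : space R) (E : sheaf Y) := Subsheaf {
  mem :> forall U, set (E U);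
  mem0 : forall U, mem (0 : E U);
  memB : forall U (s t : E U), mem s -> mem t -> mem (s - t);
  mem_act : forall (U : opens Y) f (s : E U), regular U f -> mem s -> mem (act E f s);
  mem_res : forall (U V : opens Y) (h : V `<=` U) (s : E U), mem s -> mem (res E h s);
  mem_glue : forall (U : opens Y) (I : Type) (V : I -> opens Y) (h : forall i, V i `<=` U)
    (s : E U), U `<=` \bigcup_i V i -> (forall i, mem (res E (h i) s)) -> mem s }.

Section SheafOfSub.
Variables (R : realType) (Y : space R) (E : sheaf Y) (S : subsheaf E).

Section Sections.
Variable U : opens Y.
Definition smem : {pred E U} := fun s => `[< S U s >].
Lemma smemP s : reflect (S U s) (s \in smem).
Proof. exact: asboolP. Qed.
Lemma smem_zmod : zmod_closed smem.
Proof.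
split; first by apply/smemP; exact: mem0.
by move=> s t /smemP hs /smemP ht; apply/smemP; exact: memB.
Qed.
HB.instance Definition _ := GRing.isZmodClosed.Build (E U) smem smem_zmod.
Definition subsec := {s : E U | s \in smem}.
HB.instance Definition _ := SubChoice.on subsec.
HB.instance Definition _ := [SubChoice_isSubZmodule of subsec by <:].
Definition mk_subsec (s : E U) (h : S U s) : subsec := exist _ s (introT (smemP s) h).
Lemma subsecP (s : subsec) : S U (val s).
Proof. by apply/smemP; exact: (valP s). Qed.
Lemma subsec_inj (s t : subsec) : val s = val t -> s = t.
Proof. exact: val_inj. Qed.
End Sections.

Let sact (U : opens Y) (g : Y -> R[i]) (s : subsec U) : subsec U :=
  if pselect (S U (act E g (val s))) is left h then mk_subsec h else 0.
Let sactM (U : opens Y) g (s : subsec U) : S U (act E g (val s)) ->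
  val (sact g s) = act E g (val s).
Proof. by move=> h; rewrite /sact; case: pselect. Qed.
Let sactE (U : opens Y) g (s : subsec U) : regular U g -> val (sact g s) = act E g (val s).
Proof.
by move=> hg; apply: sactM; apply: mem_act => //; exact: subsecP.
Qed.
Let sres (U V : opens Y) (h : V `<=` U) (s : subsec U) : subsec V :=
  mk_subsec (mem_res h (subsecP s)).

Definition sheaf_of_sub : sheaf Y.
Proof.
refine (@Sheaf R Y (fun U => subsec U : zmodType) sact sres _ _ _ _ _ _ _ _ _ _).
- by move=> U g g' s gg'; rewrite /sact (act_ext (val s) gg').
- by move=> U g s t hg; apply: subsec_inj; rewrite !sactE // raddfD actDr //= !sactE.
- move=> U g g' s hg hg'; apply: subsec_inj; rewrite raddfD /= (sactE s hg) (sactE s hg').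
  rewrite sactM; first exact: actDl.
  by rewrite actDl // -(sactE s hg) -(sactE s hg') -raddfD; exact: subsecP.
- move=> U g g' s hg hg'; apply: subsec_inj; rewrite (sactE _ hg) (sactE s hg').
  rewrite sactM; first exact: actM.
  by rewrite actM // -(sactE s hg') -(sactE _ hg); exact: subsecP.
- move=> U s; apply: subsec_inj; rewrite sactM; rewrite act1 //; exact: subsecP.
- by move=> U V h s t; apply: subsec_inj; rewrite raddfD /= resD.
- move=> U V h g s hg; apply: subsec_inj => /=.
  rewrite sactE // res_act // sactE //; first by move=> y /h; exact: hg.
- by move=> U h s; apply: subsec_inj; exact: res_id.
- by move=> U V W h k l s; apply: subsec_inj; exact: res_comp.
- move=> U I V h s cov comp.
  have [|t [tP tU]] := @sheaf_glue R Y E U I V h (fun i => val (s i)) cov.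
    by move=> i j W hi hj; have /(congr1 val) := comp i j W hi hj.
  have tS : S U t by apply: (mem_glue (h := h) cov) => i; rewrite tP; exact: subsecP.
  exists (mk_subsec tS); split; first by move=> i; apply: subsec_inj; exact: tP.
  by move=> t' t'P; apply: subsec_inj; apply: tU => i; rewrite -t'P.
Defined.
End SheafOfSub.

Section Curve.
Variables (R : realType) (X : curve R).
Local Notation C := (R[i]).

Record line_bundle := LineBundle {
  lb_sheaf :> sheaf X;
  lb_free : locally_free lb_sheaf 1 }.

Lemma sub_otop (U : opens X) : U `<=` otop X.
Proof. by []. Qed.

(* C-linear derivations from the structure sheaf of X to M *)
Definition derivation (M : sheaf X) (d : forall U : opens X, (X -> C) -> M U) :=
  [/\ forall (U : opens X) c, d U (fun=> c) = 0,
      forall (U : opens X) f g, regular U f -> regular U g ->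
        d U (fun x => f x + g x) = d U f + d U g,
      forall (U : opens X) f g, regular U f -> regular U g ->
        d U (fun x => f x * g x) = act M f (d U g) + act M g (d U f),
      forall (U : opens X) f g, (forall x, U x -> f x = g x) -> d U f = d U g
    & forall (U V : opens X) (h : V `<=` U) f, regular U f -> res M h (d U f) = d V f].

(* K is the sheaf of Kaehler differentials of X. *)
Definition is_canonical (K : line_bundle) :=
  exists2 d, derivation d & forall (M : sheaf X) (d' : forall U : opens X, (X -> C) -> M U),
    derivation d' -> exists h : hom K M,
      (forall (U : opens X) f, regular U f -> h U (d U f) = d' U f) /\
      (forall h' : hom K M, (forall (U : opens X) f, regular U f -> h' U (d U f) = d' U f) ->
         forall U s, h' U s = h U s).

(* The meromorphic germ f has order m at p. *)
Definition has_order (p : X) (f : X -> C) (m : int) := exists t u,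
  [/\ uniformizer p t, reg p u, u p != 0
    & \forall y \near p, y != p -> f y = u y * t y ^ m].

(* deg E = d, computed from a frame e over the complement of the points of D: near
   p in D, e = A e' for a local frame e', and p contributes the order of det A. *)
Definition has_degree (E : sheaf X) (r : nat) (d : int) :=
  exists (U : opens X) (e : 'I_r -> E U) (D : seq X) (m : X -> int),
  [/\ frame e, uniq D, (forall p, (p \in D) <-> ~ U p), d = \sum_(p <- D) m p
    & forall p, p \in D -> exists (V : opens X) (e' : 'I_r -> E V) (A : X -> 'M[C]_r),
      [/\ V p, frame e', has_order p (fun x => \det (A x)) (m p)
        & forall (W : opens X) (WU : W `<=` U) (WV : W `<=` V),
          (forall i j, regular W (fun x => A x i j)) /\
          forall i, res E WU (e i) = lincomb WV (fun j x => A x i j) e']].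

(* Functions vanishing to order at least D p at every p, for an effective divisor
   D given by its multiplicities. *)
Definition in_ideal (D : X -> nat) (V : opens X) (f : X -> C) :=
  forall p, V p -> exists t g,
    [/\ uniformizer p t, reg p g & \forall y \near p, f y = t y ^+ D p * g y].

Lemma in_idealM D (V : opens X) f g : regular V f -> in_ideal D V g ->
  in_ideal D V (fun x => f x * g x).
Proof.
move=> hf hg p Vp; have [t [k [ht hk kE]]] := hg p Vp.
exists t, (fun x => f x * k x); split=> //.
  by apply: (ag_mul (curve_alg_germs X)) => //; exact: hf.
by apply: filterS kE => y ->; rewrite mulrCA.
Qed.

Lemma in_ideal_reg D (V : opens X) f : in_ideal D V f -> regular V f.
Proof.
move=> hf p Vp; have [t [k [[ht _ _] hk kE]]] := hf p Vp.
have aX := curve_alg_germs X.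
apply: (ag_germ aX (f := fun x => t x ^+ D p * k x)).
  by apply: filterS kE => y ->.
apply: (ag_mul aX) => //; elim: (D p) => [|n IH].
  by apply: (ag_germ aX (f := fun=> 1)); [exact: (filterE (F := nbhs p))|exact: ag_cst].
apply: (ag_germ aX (f := fun x => t x * t x ^+ n)); last exact: (ag_mul aX).
by apply: (filterE (F := nbhs p)) => y; rewrite exprS.
Qed.

Lemma in_idealS D (V W : opens X) f : W `<=` V -> in_ideal D V f -> in_ideal D W f.
Proof. by move=> h hf p /h; exact: hf. Qed.

(* N(-D), the product of N with the ideal sheaf of D; as N is locally free this is
   the image of N (x) O(-D) in N, to which it is isomorphic. *)
Section Twist.
Variables (N : sheaf X) (D : X -> nat).

Let tmem (U : opens X) (s : N U) := forall x, U x ->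
  exists (V : opens X) (VU : V `<=` U), V x /\
  exists (m : nat) (f : 'I_m -> X -> C) (t : 'I_m -> N V),
    (forall i, in_ideal D V (f i)) /\ res N VU s = \sum_i act N (f i) (t i).

Lemma act0r (U : opens X) f : regular U f -> act N f (0 : N U) = 0.
Proof. by move=> hf; apply: (addrI (act N f 0)); rewrite -actDr // !addr0. Qed.
Lemma actNr (U : opens X) f (s : N U) : regular U f -> act N f (- s) = - act N f s.
Proof.
by move=> hf; apply: (addrI (act N f s)); rewrite -actDr // !subrr act0r.
Qed.
Lemma act_sumr (U : opens X) f m (s : 'I_m -> N U) : regular U f ->
  act N f (\sum_i s i) = \sum_i act N f (s i).
Proof.
move=> hf; apply: (big_morph (act N f)); first by move=> *; exact: actDr.
exact: act0r.
Qed.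
Lemma res0 (U V : opens X) (h : V `<=` U) : res N h 0 = 0.
Proof. by apply: (addrI (res N h 0)); rewrite -resD !addr0. Qed.
Lemma resN (U V : opens X) (h : V `<=` U) s : res N h (- s) = - res N h s.
Proof. by apply: (addrI (res N h s)); rewrite -resD !subrr res0. Qed.
Lemma res_sum (U V : opens X) (h : V `<=` U) m (s : 'I_m -> N U) :
  res N h (\sum_i s i) = \sum_i res N h (s i).
Proof. by apply: (big_morph (res N h)); [move=> *; exact: resD|exact: res0]. Qed.

Definition twist : subsheaf N.
Proof.
refine (@Subsheaf R X N tmem _ _ _ _ _).
- move=> U x Ux; exists U, (@subset_refl _ U); split=> //.
  exists 0%N, (fun _ _ => 0), (fun=> 0); split; first by case.
  by rewrite res0 big_ord0.
- move=> U s t hs ht x Ux.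
  have [V [VU [Vx [m [f [a [hf sE]]]]]]] := hs x Ux.
  have [V' [VU' [Vx' [m' [f' [a' [hf' tE]]]]]]] := ht x Ux.
  have wl : omeet V V' `<=` V by move=> y [].
  have wr : omeet V V' `<=` V' by move=> y [].
  have wU : omeet V V' `<=` U by move=> y [/VU].
  exists (omeet V V'), wU; split=> //.
  exists (m + m')%N, (fun i => match fintype.split i with inl j => f j | inr j => f' j end),
    (fun i => match fintype.split i with inl j => res N wl (a j) | inr j => - res N wr (a' j) end).
  split.
    by move=> i; case: fintype.splitP => j _; [exact: in_idealS (hf j)|exact: in_idealS (hf' j)].
  rewrite resD resN -(res_comp VU wl) -(res_comp VU' wr) sE tE !res_sum.
  rewrite big_split_ord /= -sumrN; congr (_ + _); apply: eq_bigr => i _.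
    rewrite -[lshift _ _]/(unsplit (inl _ i)) unsplitK res_act //.
    exact: in_ideal_reg (hf i).
  have regf' := in_ideal_reg (hf' i).
  rewrite -[rshift _ _]/(unsplit (inr _ i)) unsplitK res_act // actNr //.
  by move=> y /wr; exact: regf'.
- move=> U g s hg hs x Ux; have [V [VU [Vx [m [f [a [hf sE]]]]]]] := hs x Ux.
  have hgV : regular V g by move=> y /VU; exact: hg.
  exists V, VU; split=> //; exists m, (fun i y => g y * f i y), a; split.
    by move=> i; exact: in_idealM.
  rewrite res_act // sE act_sumr //; apply: eq_bigr => i _.
  by rewrite actM //; exact: in_ideal_reg (hf i).
- move=> U V h s hs x Vx; have [W [WU [Wx [m [f [a [hf sE]]]]]]] := hs x (h x Vx).
  have wl : omeet V W `<=` W by move=> y [].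
  have wV : omeet V W `<=` V by move=> y [].
  exists (omeet V W), wV; split=> //; exists m, f, (fun i => res N wl (a i)); split.
    by move=> i; exact: in_idealS (hf i).
  have wU : omeet V W `<=` U by move=> y [_ /WU].
  rewrite (res_comp h wV wU) -(res_comp WU wl wU) sE res_sum; apply: eq_bigr => i _.
  by rewrite res_act //; exact: in_ideal_reg (hf i).
- move=> U I V h s cov hs x /cov[i _ Vx].
  have [W [WV [Wx [m [f [a [hf sE]]]]]]] := hs i x Vx.
  have WU : W `<=` U by move=> y /WV/h.
  exists W, WU; split=> //; exists m, f, a; split=> //.
  by rewrite -sE (res_comp (h i) WV WU).
Defined.
End Twist.

Section Higgs.
Variable K : line_bundle.

(* A Higgs sheaf: for every local frame k of K, phi k is the O-linear endomorphism
   such that the Higgs field is phi k (x) k. *)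
Record higgs := Higgs {
  hsheaf :> sheaf X;
  phi : forall U : opens X, K U -> hsheaf U -> hsheaf U;
  phiD : forall (U : opens X) (k : K U) s t, frame1 k -> phi k (s + t) = phi k s + phi k t;
  phi_act : forall (U : opens X) (k : K U) f s, frame1 k -> regular U f ->
    phi k (act hsheaf f s) = act hsheaf f (phi k s);
  phi_res : forall (U V : opens X) (h : V `<=` U) (k : K U) s, frame1 k ->
    res hsheaf h (phi k s) = phi (res K h k) (res hsheaf h s);
  phi_scale : forall (U : opens X) (k : K U) u s, frame1 k -> regular U u ->
    (forall x, U x -> u x != 0) -> act hsheaf u (phi (act K u k) s) = phi k s }.

Definition hom_higgs (E F : higgs) (h : hom E F) :=
  forall (U : opens X) (k : K U) s, frame1 k -> h U (phi k s) = phi k (h U s).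

Definition semistable (E : higgs) (n : nat) :=
  forall (F : higgs) (r : nat) (h : hom F E), (0 < r)%N -> locally_free F r ->
    hom_inj h -> hom_higgs h ->
    forall d e : int, has_degree F r d -> has_degree E n e -> d * n%:Z <= e * r%:Z.

(* The global section a of K equals c k over U. *)
Definition coefficient (U : opens X) (k : K U) (a : K (otop X)) (c : X -> C) :=
  regular U c /\ res K (@sub_otop U) a = act K c k.

(* The characteristic polynomial of the Higgs field is \prod_j (T - alpha_j). *)
Definition hitchin_image (n : nat) (E : higgs) (alpha : 'I_n -> K (otop X)) :=
  forall (U : opens X) (k : K U) (e : 'I_n -> E U) (a : 'I_n -> X -> C) (M : X -> 'M[C]_n),
    frame1 k -> frame e -> (forall j, coefficient k (alpha j) (a j)) ->
    (forall i j, regular U (fun x => M x i j)) ->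
    (forall j, phi k (e j) = \sum_i act E (fun x => M x i j) (e i)) ->
    forall x, U x -> char_poly (M x) = \prod_j ('X - (a j x)%:P).

Definition hitchin_fibre (n : nat) (alpha : 'I_n -> K (otop X)) (E : higgs) :=
  [/\ locally_free E n, has_degree E n 0, semistable E n & hitchin_image E alpha].

Definition direct_sum (m : nat) (E : higgs) (F : 'I_m -> higgs) :=
  exists pr : forall k, hom E (F k), (forall k, hom_higgs (pr k)) /\
    forall U (s : forall k, F k U), exists! t : E U, forall k, pr k U t = s k.

(* Reduction of the structure group of (E, phi) from GL_n to a subgroup G with Lie
   algebra g: local frames with G-valued transition matrices in which the Higgs
   field is g-valued. *)
Definition reduction (n : nat) (E : higgs) (G g : set 'M[C]_n) :=
  exists (U : X -> opens X) (e : forall x, 'I_n -> E (U x)),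
  [/\ forall x, U x x, forall x, frame (e x),
      (forall x y, exists A : X -> 'M[C]_n, (forall z, U x z -> U y z -> G (A z)) /\
        forall (W : opens X) (Wx : W `<=` U x) (Wy : W `<=` U y),
          (forall i j, regular W (fun z => A z i j)) /\
          forall j, res E Wy (e y j) = lincomb Wx (fun i z => A z i j) (e x))
    & forall x (W : opens X) (Wx : W `<=` U x) (k : K W), frame1 k ->
        exists M : X -> 'M[C]_n,
        [/\ forall z, W z -> g (M z), forall i j, regular W (fun z => M z i j)
          & forall j, phi k (res E Wx (e x j)) = lincomb Wx (fun i z => M z i j) (e x)]].

Record subhiggs (E : higgs) := Subhiggs {
  sh_sub :> subsheaf E;
  sh_phi : forall (U : opens X) (k : K U) s, frame1 k -> sh_sub U s -> sh_sub U (phi k s) }.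

(* S' / S, with the induced Higgs field, is isomorphic to (Q, a). *)
Definition quotient_iso (E : higgs) (S' S : subhiggs E) (Q : sheaf X) (a : K (otop X)) :=
  (forall U, S U `<=` S' U) /\
  exists h : hom (sheaf_of_sub S') Q,
  [/\ hom_surj h, forall U (s : subsec S' U), h U s = 0 <-> S U (val s)
    & forall (U : opens X) (k : K U) c (s t : subsec S' U), frame1 k -> coefficient k a c ->
        val t = phi k (val s) -> h U t = act Q c (h U s)].
End Higgs.
End Curve.

(* Block diagonal matrices of block sizes sh with upper triangular blocks: the Lie
   algebra of a product of Borel subgroups, and its group of units. *)
Definition borel_lie (F : fieldType) (n : nat) (sh : seq nat) : set 'M[F]_n :=
  [set A | forall i j : 'I_n, ~~ ((reshape_index sh i == reshape_index sh j) && (i <= j)%N) ->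
     A i j = 0].
Definition borel_prod (F : fieldType) (n : nat) (sh : seq nat) : set 'M[F]_n :=
  [set A | borel_lie sh A /\ A \in unitmx].

Section TotalSpace.
Variables (R : realType) (X : curve R) (K : line_bundle X).
Local Notation C := (R[i]).

Let aX := curve_alg_germs X.

(* X x A^1: regular functions are locally quotients of polynomials in the second
   coordinate whose coefficients are regular functions on X. *)
Definition cyl_pt := (X * C)%type.
HB.instance Definition _ := Choice.on cyl_pt.

Definition poly_on (V : opens X) (q : X -> {poly C}) :=
  (exists m : nat, forall x, (size (q x) <= m)%N) /\
  forall i : nat, regular V (fun x => (q x)`_i).

Lemma poly_onS (V W : opens X) q : W `<=` V -> poly_on V q -> poly_on W q.
Proof. by move=> h [hm hq]; split=> // i x /h; exact: hq. Qed.

Lemma reg_sum p n (f : 'I_n -> X -> C) : (forall i, reg p (f i)) ->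
  reg p (fun x => \sum_i f i x).
Proof.
elim: n f => [|n IH] f hf.
  apply: (ag_germ aX (f := fun=> 0)); last exact: ag_cst.
  by apply: (filterE (F := nbhs p)) => y; rewrite big_ord0.
apply: (ag_germ aX (f := fun x => \sum_(i < n) f (widen_ord (leqnSn n) i) x + f ord_max x)).
  by apply: (filterE (F := nbhs p)) => y; rewrite big_ord_recr.
by apply: (ag_add aX) => //; apply: IH.
Qed.

Lemma reg_exp p (f : X -> C) n : reg p f -> reg p (fun x => f x ^+ n).
Proof.
move=> hf; elim: n => [|n IH].
  by apply: (ag_germ aX (f := fun=> 1)); [exact: (filterE (F := nbhs p))|exact: ag_cst].
apply: (ag_germ aX (f := fun x => f x * f x ^+ n)); last exact: (ag_mul aX).
by apply: (filterE (F := nbhs p)) => y; rewrite exprS.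
Qed.

Lemma poly_on_eval (V : opens X) q p (a : X -> C) : poly_on V q -> V p -> reg p a ->
  reg p (fun x => (q x).[a x]).
Proof.
move=> [[m hm] hq] Vp ha.
apply: (ag_germ aX (f := fun x => \sum_(i < m) (q x)`_i * a x ^+ i)).
  by apply: (filterE (F := nbhs p)) => y; rewrite (horner_coef_wide _ (hm y)).
by apply: reg_sum => i; apply: (ag_mul aX); [exact: hq|exact: reg_exp].
Qed.

Lemma poly_on1 V : poly_on V (fun=> 1).
Proof.
split; first by exists 1%N => x; rewrite size_poly1.
by move=> i x _; exact: ag_cst.
Qed.

Lemma poly_onM (V : opens X) q r : poly_on V q -> poly_on V r ->
  poly_on V (fun x => q x * r x).
Proof.
move=> [[m hm] hq] [[l hl] hr]; split.
  exists (m + l)%N => x; apply: leq_trans (size_polyMleq _ _) _.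
  by apply: leq_trans (leq_pred _) _; exact: leq_add.
move=> i p Vp; apply: (ag_germ aX (f := fun x => \sum_(j < i.+1) (q x)`_j * (r x)`_(i - j))).
  by apply: (filterE (F := nbhs p)) => y; rewrite coefM.
by apply: reg_sum => j; apply: (ag_mul aX); [exact: hq|exact: hr].
Qed.

Definition cyl_open (U : set cyl_pt) := forall z, U z -> exists (V : opens X) q,
  [/\ V z.1, poly_on V q, (q z.1).[z.2] != 0 &
      forall x c, V x -> (q x).[c] != 0 -> U (x, c)].

Definition cyl_reg (z : cyl_pt) (f : cyl_pt -> C) := exists (V : opens X) q r,
  [/\ V z.1, poly_on V q, poly_on V r, (r z.1).[z.2] != 0 &
      forall x c, V x -> (r x).[c] != 0 -> f (x, c) = (q x).[c] / (r x).[c]].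

(* The fibre of K at p consists of the classes of local sections at p modulo those
   in m_p K. *)
Definition local_section := {U : opens X & K U}.
Definition germ (U : opens X) (s : K U) : local_section := existT (fun U => K U) U s.

Definition same_value (p : X) (s t : local_section) :=
  exists (W : opens X) (hs : W `<=` tag s) (ht : W `<=` tag t),
  W p /\ exists f r, [/\ regular W f, f p = 0 &
    res K hs (tagged s) - res K ht (tagged t) = act K f r].

(* A point of |K|: a point p of X with an element of the fibre of K at p. *)
Record tot_pt := Tot {
  tot_base : X;
  tot_vec : set local_section;
  totP : exists s : local_section, tag s tot_base /\ tot_vec = same_value tot_base s }.
HB.instance Definition _ := gen_eqMixin tot_pt.
HB.instance Definition _ := gen_choiceMixin tot_pt.

Definition value (p : X) (U : opens X) (Up : U p) (s : K U) : tot_pt :=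
  @Tot p (same_value p (germ s))
    (ex_intro _ (germ s) (conj Up erefl)).

(* The trivialization of |K| over U defined by a section k of K over U (junk value
   outside U). *)
Definition chart (U : opens X) (k : K U) (z : cyl_pt) : tot_pt :=
  if pselect (U z.1) is left h then value h (act K (fun=> z.2) k)
  else value (I : otop X z.1) 0.

Definition tot_open (O : set tot_pt) := forall (U : opens X) (k : K U), frame1 k ->
  cyl_open [set z | U z.1 /\ O (chart k z)].

Lemma tot_openT : tot_open setT.
Proof.
move=> U k hk z [Uz _]; exists U, (fun=> 1); split=> //; first exact: poly_on1.
by rewrite hornerC oner_eq0.
Qed.

Lemma tot_openI : setI_closed tot_open.
Proof.
move=> A B hA hB U k hk z [Uz [Az Bz]].
have [V [q [Vz hq qz qA]]] := hA U k hk z (conj Uz Az).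
have [W [r [Wz hr rz rB]]] := hB U k hk z (conj Uz Bz).
exists (omeet V W), (fun x => q x * r x); split=> //.
- by apply: poly_onM; [apply: poly_onS hq => x []|apply: poly_onS hr => x []].
- by rewrite hornerM mulf_neq0.
- move=> x c [Vx Wx]; rewrite hornerM mulf_eq0 negb_or => /andP[qx rx].
  by have [? ?] := qA x c Vx qx; have [? ?] := rB x c Wx rx.
Qed.

Lemma tot_open_bigU (I : Type) (F : I -> set tot_pt) :
  (forall i, tot_open (F i)) -> tot_open (\bigcup_i F i).
Proof.
move=> hF U k hk z [Uz [i _ Fz]]; have [V [q [Vz hq qz qF]]] := hF i U k hk z (conj Uz Fz).
by exists V, q; split=> // x c Vx /(qF x c Vx)[Ux Fx]; split=> //; exists i.
Qed.

HB.instance Definition _ := isOpenTopological.Build tot_pt tot_openT tot_openI tot_open_bigU.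

Definition tot : space R := @Space R tot_pt (fun y f =>
  forall (U : opens X) (k : K U) c, frame1 k -> U (tot_base y) ->
    y = chart k (tot_base y, c) -> cyl_reg (tot_base y, c) (f \o chart k)).

(* The tautological section is lambda = (tautological k) k over U. *)
Definition tautological (U : opens X) (k : K U) (y : tot_pt) : C :=
  xget 0 [set c | y = chart k (tot_base y, c)].

Definition tot_section (a : K (otop X)) (p : X) : tot := value (I : otop X p) a.

Lemma tot_pt_eq (y z : tot_pt) : tot_base y = tot_base z -> tot_vec y = tot_vec z -> y = z.
Proof.
case: y => p v h; case: z => p' v' h' /= e e'; subst p' v'.
by rewrite (Prop_irrelevance h h').
Qed.

Lemma lincomb1 (U V : opens X) (VU : V `<=` U) f (e : K U) :
  lincomb VU f (fun _ : 'I_1 => e) = act K (f ord0) (res K VU e).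
Proof. by rewrite /lincomb big_ord1. Qed.

(* Differences of the form f r, with f in m_p, are closed under sums, as K has rank 1. *)
Lemma vanish_add p (W : opens X) f f' (r r' : K W) : W p -> regular W f -> regular W f' ->
  f p = 0 -> f' p = 0 ->
  exists (V : opens X) (VW : V `<=` W) g t, [/\ V p, regular V g, g p = 0
    & res K VW (act K f r + act K f' r') = act K g t].
Proof.
move=> Wp hf hf' f0 f'0; have [U [Up [e he]]] := lb_free K p.
have VU : omeet W U `<=` U by move=> x [].
have VW : omeet W U `<=` W by move=> x [].
have [a [ha aE _]] := he _ VU (res K VW r).
have [b [hb bE _]] := he _ VU (res K VW r').
have hfV : regular (omeet W U) f by move=> x /VW; exact: hf.
have hf'V : regular (omeet W U) f' by move=> x /VW; exact: hf'.
exists (omeet W U), VW, (fun x => f x * a ord0 x + f' x * b ord0 x), (res K VU (e ord0)).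
have r1 : regular (omeet W U) (fun x => f x * a ord0 x).
  by move=> x Vx; apply: (ag_mul aX); [exact: hfV|exact: ha].
have r2 : regular (omeet W U) (fun x => f' x * b ord0 x).
  by move=> x Vx; apply: (ag_mul aX); [exact: hf'V|exact: hb].
split=> //.
- by move=> x Vx; apply: (ag_add aX); [exact: r1|exact: r2].
- by rewrite f0 f'0 !mul0r addr0.
- rewrite resD !res_act // aE bE /lincomb !big_ord1 -!actM //.
  by rewrite actDl.
Qed.

Lemma same_value_sym p s t : same_value p s t -> same_value p t s.
Proof.
move=> [W [hs [ht [Wp [f [r [hf f0 E]]]]]]]; exists W, ht, hs; split=> //.
by exists f, (- r); split=> //; rewrite actNr // -E opprB.
Qed.

Lemma same_value_trans p s t u : same_value p s t -> same_value p t u -> same_value p s u.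
Proof.
move=> [W [hs [ht [Wp [f [r [hf f0 E]]]]]]] [W' [ht' [hu [Wp' [f' [r' [hf' f'0 E']]]]]]].
have wl : omeet W W' `<=` W by move=> x [].
have wr : omeet W W' `<=` W' by move=> x [].
have hfM : regular (omeet W W') f by move=> x /wl; exact: hf.
have hf'M : regular (omeet W W') f' by move=> x /wr; exact: hf'.
have [V [VM [g [v [Vp hg g0 gE]]]]] :=
  @vanish_add p (omeet W W') f f' (res K wl r) (res K wr r') (conj Wp Wp') hfM hf'M f0 f'0.
have hsV : V `<=` tag s by move=> x /VM/wl/hs.
have huV : V `<=` tag u by move=> x /VM/wr/hu.
exists V, hsV, huV; split=> //; exists g, v; split=> //; rewrite -gE -!res_act //.
rewrite -E -E'.
have htM : omeet W W' `<=` tag t by move=> x /wl/ht.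
have hsM : omeet W W' `<=` tag s by move=> x /wl/hs.
have huM : omeet W W' `<=` tag u by move=> x /wr/hu.
rewrite !resD !resN !(res_comp _ _ hsM) !(res_comp _ _ huM) !(res_comp _ _ htM) addrA subrK.
by rewrite (res_comp hsM VM hsV) (res_comp huM VM huV).
Qed.

Lemma same_value_refl p (s : local_section) : tag s p -> same_value p s s.
Proof.
move=> sp; exists (tag s), (@subset_refl _ _), (@subset_refl _ _); split=> //.
exists (fun=> 0), 0; split=> //; first by move=> x _; exact: ag_cst.
by rewrite subrr act0r // => x _; exact: ag_cst.
Qed.

Lemma value_eq p (U V : opens X) (Up : U p) (Vp : V p) (s : K U) (t : K V) :
  same_value p (germ s) (germ t) -> value Up s = value Vp t.
Proof.
move=> h; apply: tot_pt_eq => //=; apply/seteqP; split=> u hu.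
  exact: same_value_trans (same_value_sym h) hu.
exact: same_value_trans h hu.
Qed.

Lemma chart_base (U : opens X) (k : K U) z : tot_base (chart k z) = z.1.
Proof. by rewrite /chart; case: pselect. Qed.

Lemma chart_tot_section (U : opens X) (k : K U) (a : K (otop X)) c p :
  coefficient k a c -> U p -> tot_section a p = chart k (p, c p).
Proof.
move=> [hc cE] Up; rewrite /chart /=; case: pselect => // h; apply: value_eq.
exists U, (@sub_otop R X U), (@subset_refl _ _); split=> //=.
have rc : regular U (fun=> c p) by move=> x _; exact: ag_cst.
have rN : regular U (fun=> - c p) by move=> x _; exact: ag_cst.
exists (fun x => c x - c p), k; split.
- by move=> x Ux; apply: (ag_add aX); [exact: hc|exact: ag_cst].
- by rewrite subrr.
- rewrite cE res_id -actNr // actDl //; congr (_ + _).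
  apply: (addrI (act K (fun=> c p) k)); rewrite actNr // subrr -actDl //.
  rewrite (act_ext (g := fun=> 0)); last by move=> x _; rewrite subrr.
  apply: (addrI (act K (fun=> 0) k)).
  have r0 : regular U (fun=> 0 : C) by move=> x _; exact: ag_cst.
  rewrite addr0 -actDl //; by apply: act_ext => x _; rewrite addr0.
Qed.

Lemma has_chart p (a : K (otop X)) : exists (U : opens X) (k : K U) c,
  [/\ U p, frame1 k & coefficient k a c].
Proof.
have [U [Up [e he]]] := lb_free K p; exists U, (e ord0).
have e1 : frame1 (e ord0).
  by rewrite /frame1; move: he; congr (frame _); apply/funext => i; rewrite ord1.
have [f [hf fE _]] := he U (@subset_refl _ _) (res K (@sub_otop R X U) a).
exists (f ord0); split=> //; split; first exact: hf.
by rewrite fE /lincomb big_ord1 res_id.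
Qed.

Lemma tot_section_near (a : K (otop X)) p (O : set tot) : open O -> O (tot_section a p) ->
  \forall x \near p, O (tot_section a x).
Proof.
move=> hO Op; have [U [k [c [Up hk hc]]]] := has_chart p a.
have [V [q [Vp hq qp qO]]] : exists (V : opens X) q,
    [/\ V p, poly_on V q, (q p).[c p] != 0 &
      forall x d, V x -> (q x).[d] != 0 -> U x /\ O (chart k (x, d))].
  have := hO U k hk (p, c p); apply; split=> //=.
  by rewrite -(chart_tot_section hc).
have qn : \forall x \near p, (q x).[c x] != 0.
  by apply: (ag_near aX) => //; apply: (poly_on_eval hq Vp); exact: hc.1.
have Vn : \forall x \near p, V x by apply: open_nbhs_nbhs; split=> //; exact: ocarP.
apply: filterS2 qn Vn => x qx Vx; have [Ux Ox] := qO x _ Vx qx.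
by rewrite (chart_tot_section hc).
Qed.

Lemma tot_section_reg (a : K (otop X)) p f : reg (tot_section a p) f ->
  reg p (f \o tot_section a).
Proof.
move=> hf; have [U [k [c [Up hk hc]]]] := has_chart p a.
have [V [q [r [Vp hq hr rp fE]]]] := hf U k (c p) hk Up (chart_tot_section hc Up).
have rn : \forall x \near p, (r x).[c x] != 0.
  by apply: (ag_near aX) => //; apply: (poly_on_eval hr Vp); exact: hc.1.
have Vn : \forall x \near p, V x by apply: open_nbhs_nbhs; split=> //; exact: ocarP.
have Un : \forall x \near p, U x by apply: open_nbhs_nbhs; split=> //; exact: ocarP.
apply: (ag_germ aX (f := fun x => (q x).[c x] * ((r x).[c x])^-1)).
  apply: filterS2 (filterI rn Vn) Un => x [rx Vx] Ux.
  by rewrite /= (chart_tot_section hc Ux); rewrite -fE.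
apply: (ag_mul aX); first by apply: (poly_on_eval hq Vp); exact: hc.1.
apply: (ag_inv aX) => //; apply: (poly_on_eval hr Vp); exact: hc.1.
Qed.
End TotalSpace.

Section Spectral.
Variables (R : realType) (X : curve R) (K : line_bundle X) (n : nat).
Variable alpha : 'I_n -> K (otop X).
Local Notation C := (R[i]).

(* The zero locus of \prod_j (lambda - alpha_j) in |K|, in local coordinates. *)
Definition spectral_curve : space R := subspace [set y : tot K |
  exists (U : opens X) (k : K U) (c : C) (a : 'I_n -> X -> C),
    [/\ U (tot_base y), frame1 k, y = chart k (tot_base y, c),
        forall j, coefficient k (alpha j) (a j)
      & (\prod_j ('X - (a j (tot_base y))%:P)).[c] = 0]].

Definition spectral_base (y : spectral_curve) : X := tot_base (sub_incl y).

Lemma tot_base_open (U : opens X) : open [set y : tot K | U (tot_base y)].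
Proof.
move=> V k hk [p c] [/= Vp]; rewrite chart_base /= => Up.
exists (omeet U V), (fun=> 1); split=> //=; first exact: poly_on1.
  by rewrite hornerC oner_eq0.
by move=> x d [Ux Vx] _; split=> //; rewrite chart_base.
Qed.

Lemma spectral_base_cont : continuous spectral_base.
Proof.
apply/continuousP => A hA; exists [set y : tot K | A (tot_base y)] => //.
exact: (@tot_base_open (Opens hA)).
Qed.

Lemma spectral_base_reg (y : spectral_curve) f : reg (spectral_base y) f ->
  reg y (f \o spectral_base).
Proof.
move=> hf; exists (fun z : tot K => f (tot_base z)); last exact: (filterE (F := nbhs y)).
move=> U k c hk Uy yE.
have : nbhs (spectral_base y) [set z | reg z f] by exact: (ag_open (curve_alg_germs X)).
rewrite nbhsE => -[W [hW Wy] Wf].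
exists (Opens hW), (fun x => (f x)%:P), (fun=> 1); split=> //=.
- split; first by exists 1%N => x; exact: size_polyC_leq1.
  move=> i x Wx; have aX := curve_alg_germs X.
  case: i => [|i].
    apply: (ag_germ aX (f := f)); last exact: Wf.
    by apply: (filterE (F := nbhs x)) => z; rewrite coefC.
  apply: (ag_germ aX (f := fun=> 0)); last exact: ag_cst.
  by apply: (filterE (F := nbhs x)) => z; rewrite coefC.
- exact: poly_on1.
- by rewrite hornerC oner_eq0.
- by move=> x d _ _; rewrite chart_base !hornerC divr1.
Qed.

Definition spectral_pi : morphism spectral_curve X :=
  Morphism spectral_base_cont spectral_base_reg.

Lemma branch_subproof (j : 'I_n) (p : X) : exists (U : opens X) (k : K U) (c : C)
    (a : 'I_n -> X -> C),
    [/\ U (tot_base (tot_section (alpha j) p)), frame1 k,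
        tot_section (alpha j) p = chart k (tot_base (tot_section (alpha j) p), c),
        forall j, coefficient k (alpha j) (a j)
      & (\prod_j ('X - (a j (tot_base (tot_section (alpha j) p)))%:P)).[c] = 0].
Proof.
have [U [k [c [Up hk hc]]]] := has_chart p (alpha j).
have ex i : exists a, coefficient k (alpha i) a.
  have [f [hf fE _]] := hk U (@subset_refl _ _) (res K (@sub_otop R X U) (alpha i)).
  exists (f ord0); split; first exact: hf.
  by rewrite fE /lincomb big_ord1 res_id.
pose a i := projT1 (cid (ex i)).
have ha i : coefficient k (alpha i) (a i) by exact: projT2 (cid (ex i)).
exists U, k, (a j p), a; split=> //=; first exact: chart_tot_section (ha j) Up.
by rewrite (bigD1 j) //= hornerM hornerXsubC subrr mul0r.
Qed.

(* The component X_j = alpha_j(X) is the range of branch j. *)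
Definition branch (j : 'I_n) (p : X) : spectral_curve := sub_mk (branch_subproof j p).

Definition on_branch (j : 'I_n) : set spectral_curve := range (branch j).

Definition node (j k : 'I_n) : set spectral_curve := on_branch j `&` on_branch k.

Definition nodes : set spectral_curve :=
  [set y | exists j k, j != k /\ node j k y].

(* v lies in V^nod: the zeros of alpha_j - alpha_k are simple. *)
Definition in_Vnod :=
  [/\ injective alpha,
      forall j k, j != k -> forall (U : opens X) (e : K U) c p, frame1 e ->
        coefficient e (alpha j - alpha k) c -> U p -> c p = 0 -> uniformizer p c
    & forall i j k, i != j -> i != k -> j != k -> node i j `&` node i k = set0].

Section PartialNormalization.
Variable Q : set spectral_curve.

Definition branches (j : 'I_n) (y : spectral_curve) : {set 'I_n} :=
  if `[< Q y >] then [set j]%SET else [set k | `[< on_branch k y >]]%SET.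

(* The points over y are y itself, carrying all branches through y, if y is not in
   Q, and otherwise one point for each branch through y. *)
Record pn_pt := Pn {
  pn_img : spectral_curve;
  pn_br : {set 'I_n};
  pnP : exists j p, pn_img = branch j p /\ pn_br = branches j pn_img }.
HB.instance Definition _ := gen_eqMixin pn_pt.
HB.instance Definition _ := gen_choiceMixin pn_pt.

(* The irreducible component \tilde X_j is the range of component j, which is inverse to
   the isomorphism induced by the projection to X. *)
Definition component (j : 'I_n) (p : X) : pn_pt :=
  @Pn (branch j p) (branches j (branch j p)) (ex_intro _ j (ex_intro _ p (conj erefl erefl))).

Definition pn_open (O : set pn_pt) := forall j, open (component j @^-1` O).

Lemma pn_openT : pn_open setT.
Proof. by move=> j; exact: openT. Qed.
Lemma pn_openI : setI_closed pn_open.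
Proof. by move=> A B hA hB j; exact: openI (hA j) (hB j). Qed.
Lemma pn_open_bigU (I : Type) (F : I -> set pn_pt) :
  (forall i, pn_open (F i)) -> pn_open (\bigcup_i F i).
Proof.
by move=> hF j; rewrite preimage_bigcup; apply: bigcup_open => i _; exact: hF.
Qed.
HB.instance Definition _ := isOpenTopological.Build pn_pt pn_openT pn_openI pn_open_bigU.

(* Isomorphic to the spectral curve away from Q, to the normalization over Q. *)
Definition partial_normalization : space R := @Space R pn_pt (fun x f =>
  (~ Q (pn_img x) -> exists2 g, reg (pn_img x) g & \forall z \near x, f z = g (pn_img z)) /\
  (Q (pn_img x) -> forall j p, component j p = x -> reg p (f \o component j))).

Lemma branch_cont j : continuous (branch j : X -> spectral_curve).
Proof.
move=> p A; rewrite nbhsE => -[_ [[O hO <-] Op] OA].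
by apply: filterS (tot_section_near hO Op) => x Ox; exact: OA.
Qed.

Lemma branch_reg j p f : reg (branch j p) f -> reg p (f \o branch j).
Proof.
move=> [g hg fE].
apply: (ag_germ (curve_alg_germs X) (f := g \o tot_section (alpha j))); last exact: tot_section_reg.
have h : \forall x \near p, f (branch j x) = g (sub_incl (branch j x)).
  exact: (@branch_cont j p _ fE).
by apply: filterS h => x /= ->.
Qed.

Lemma component_cont j : continuous (component j : X -> partial_normalization).
Proof. by apply/continuousP => A hA; exact: hA. Qed.

Lemma component_reg j p f : reg (component j p : partial_normalization) f -> reg p (f \o component j).
Proof.
move=> [h1 h2]; have [hQ|hQ] := pselect (Q (branch j p)); first exact: h2.
have [g hg fE] := h1 hQ.
apply: (ag_germ (curve_alg_germs X) (f := g \o branch j)); last exact: branch_reg.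
have h : \forall x \near p, f (component j x) = g (branch j x) by exact: (@component_cont j p _ fE).
by apply: filterS h => x /= ->.
Qed.

Definition component_incl (j : 'I_n) : morphism X partial_normalization :=
  Morphism (@component_cont j) (@component_reg j).

Lemma pn_img_cont : continuous (pn_img : partial_normalization -> spectral_curve).
Proof.
apply/continuousP => A hA.
have hj j : open (branch j @^-1` A) by move/continuousP: (@branch_cont j); apply.
exact: hj.
Qed.

Lemma pn_img_reg (x : partial_normalization) f : reg (pn_img x) f -> reg x (f \o pn_img).
Proof.
move=> hf; split=> [_|_ j p xE]; first by exists f => //; exact: (filterE (F := nbhs x)).
by apply: branch_reg; move: hf; rewrite -xE.
Qed.

Definition pn_nu : morphism partial_normalization spectral_curve :=
  Morphism pn_img_cont pn_img_reg.

(* Y enumerates the connected components, all of which are open. *)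
Definition enum_components (m : nat) (Y : 'I_m -> opens partial_normalization) :=
  (forall i, exists x, Y i = connected_component setT x :> set _) /\
  (forall x, exists! i, Y i x).

(* For R = Q: component_indices i is C_i, separating_part is R_s, and component_nodes i
   is D_i = \sum_(j < k in C_i) D_jk - R_i. *)
Section Components.
Variables (m : nat) (Y : 'I_m -> opens partial_normalization).

Definition component_indices (i : 'I_m) : {set 'I_n} :=
  [set j | `[< forall p, Y i (component j p) >]]%SET.

Definition separating_part : set spectral_curve :=
  [set y | Q y /\ exists i i' j k,
     [/\ i != i', j \in component_indices i, k \in component_indices i' & node j k y]].

Definition component_nodes (i : 'I_m) : set spectral_curve :=
  [set y | ~ Q y /\ exists j k,
     [/\ j != k, j \in component_indices i, k \in component_indices i & node j k y]].
End Components.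

(* The divisor on X corresponding to
   \sum_(l > i) \tilde X_(J i) \cap \tilde X_(J l) on \tilde X_(J i); the components
   meet transversally. *)
Definition later_nodes (r : nat) (J : r.-tuple 'I_n) (i : 'I_r) (p : X) : nat :=
  \sum_(l < r | (i < l)%N) `[< range (component (tnth J l)) (component (tnth J i) p) >].

(* A filtration 0 = F 0 < F 1 < .. < F r = E by Higgs subbundles of ranks 0, .., r,
   with graded pieces (N_(J i)(- later_nodes), alpha_(J i)). *)
Definition adapted_filtration (N : 'I_n -> sheaf X) (E : higgs K) (r : nat)
    (J : r.-tuple 'I_n) (F : nat -> subhiggs E) :=
  [/\ forall (U : opens X) (s : E U), F 0%N U s <-> s = 0,
      forall (U : opens X) (s : E U), F r U s
    & forall i : 'I_r,
      [/\ exists (U : opens X) (s : E U), F i.+1 U s /\ ~ F i U s,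
          locally_free (sheaf_of_sub (F i.+1)) i.+1
        & quotient_iso (F i.+1) (F i)
            (sheaf_of_sub (twist (N (tnth J i)) (later_nodes J i))) (alpha (tnth J i))]].
End PartialNormalization.

(* E is the push-forward of F, with Higgs field induced by multiplication by lambda. *)
Definition spectral_datum (E : higgs K) (F : sheaf spectral_curve) :=
  exists2 h : hom E (pushforward spectral_pi F), hom_iso h &
    forall (U : opens X) (k : K U) (s : E U), frame1 k ->
      h U (phi k s) = act F (U := opre spectral_pi U)
        (fun y => tautological k (sub_incl y)) (h U s).
End Spectral.

Arguments on_branch {R X K n} alpha.
Arguments node {R X K n} alpha.
Arguments nodes {R X K n} alpha.
Arguments reduction {R X K} n E G g.

(* Main.v *)
(* Restricting a section of L to the component of index j makes E a subsheaf of the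
   direct sum of the N j, with the Higgs field acting on N j as alpha_j.  Given an ordering
   J of the components, the sections that vanish on the components J l, l >= m, form the
   m-th step of a filtration; a section vanishing on all J l with l > i restricts on J i to a
   section vanishing at the later nodes.  Conversely every such section of N (J i) lifts
   locally: near a node of J i and J l, multiplication by lambda - alpha_l kills the
   component J l and is a local parameter on J i.  Adapted lifts of generators form frames,
   whose transition matrices are triangular; they are block diagonal too, as the lifts can
   be supported on one connected component.  The filtration is unique because
   phi - alpha_(J m) maps its step m + 1 into its step m, whereas alpha_(J i) - alpha_(J m)
   acts injectively on the torsion-free quotient at i for m < i. *)
Require Import Defs.
From HB Require Import structures.
From mathcomp Require Import all_boot all_order all_algebra.
From mathcomp Require Import finmap complex.
From mathcomp Require Import boolp classical_sets functions cardinality.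
From mathcomp Require Import reals topology.
From mathcomp Require Import -(notations) mpoly.
(* all_algebra shadows [space]. *)
Import Defs.

Set Implicit Arguments.
Unset Strict Implicit.
Unset Printing Implicit Defensive.

Import Order.TTheory GRing.Theory Num.Theory.
Local Open Scope classical_set_scope.
Local Open Scope ring_scope.

(** There are no stalks or tensor products at hand, so graded pieces must be exhibited by local
    sections. Both statements are therefore reduced to one local notion, [flag_section]: a section
    whose image under [rho i] generates the twist of [N i] as well as the images of all sections
    killed by the later [rho l]. Elimination along such sections yields frames, ranks, quotients and
    triangular matrices alike. The relation [below] lets one argument serve twice: it is the order
    of indices for the filtration, and that order cut down to the blocks for the Borel reduction.
    The nodal hypothesis enters the local construction in two ways. At most two components pass
    through a point, so a single factor lambda - alpha_l suffices there; and alpha_j - alpha_l has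
    simple zeros, so this factor restricts to a generator of the ideal of the node. A node in [Q]
    imposes nothing, as its two components are disjoint above it. *)

Lemma regularS (R : realType) (Y : space R) (U V : set Y) f :
  V `<=` U -> regular U f -> regular V f.
Proof. by move=> VU hf y /VU; exact: hf. Qed.

(** * Sheaves of modules *)

Section Sheaf.
Variables (R : realType) (Y : space R) (E : sheaf Y).
Implicit Types U V W : opens Y.

Lemma res_0 U V (h : V `<=` U) : res E h 0 = 0.
Proof. by apply: (addrI (res E h 0)); rewrite -resD !addr0. Qed.

Lemma res_N U V (h : V `<=` U) s : res E h (- s) = - res E h s.
Proof. by apply: (addrI (res E h s)); rewrite -resD !subrr res_0. Qed.

Lemma res_B U V (h : V `<=` U) s t : res E h (s - t) = res E h s - res E h t.
Proof. by rewrite resD res_N. Qed.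

Lemma res_irr U V (h h' : V `<=` U) s : res E h s = res E h' s.
Proof. by rewrite (Prop_irrelevance h h'). Qed.

Lemma act_r0 U f : regular U f -> act E f (0 : E U) = 0.
Proof. by move=> hf; apply: (addrI (act E f 0)); rewrite -actDr // !addr0. Qed.

Lemma act_0 U f (s : E U) : regular U (fun=> 0) -> (forall y, U y -> f y = 0) ->
  act E f s = 0.
Proof.
move=> h0 f0; rewrite (act_ext (g := fun=> 0)) //.
apply: (addrI (act E (fun=> 0) s)).
by rewrite addr0 -actDl //; apply: act_ext => y _; rewrite addr0.
Qed.

Lemma act_lB U f g (s : E U) : regular U (fun=> 0) -> regular U f -> regular U g ->
  regular U (fun x => f x - g x) ->
  act E (fun x => f x - g x) s = act E f s - act E g s.
Proof.
move=> h0 hf hg hfg; apply: (addIr (act E g s)); rewrite subrK -actDl //.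
by apply: act_ext => y _; rewrite subrK.
Qed.

(** The uniqueness half of [sheaf_glue], for a cover indexed by the points of [U]. *)
Lemma sec_sep U (s t : E U) :
  (forall x, U x -> exists V (VU : V `<=` U), V x /\ res E VU s = res E VU t) -> s = t.
Proof.
move=> h.
pose I := {x | U x}.
have hI (i : I) : {V : opens Y & {VU : V `<=` U | V (sval i) /\ res E VU s = res E VU t}}.
  by have [V hV] := cid (h _ (svalP i)); exists V; exact: cid hV.
pose V i := projT1 (hI i); pose VU i := sval (projT2 (hI i)).
have [||u [_ uu]] := @sheaf_glue R Y E U I V VU (fun i => res E (VU i) s).
- by move=> x Ux; exists (exist _ x Ux) => //; have [] := svalP (projT2 (hI (exist _ x Ux))).
- move=> i j W hi hj; have hW : W `<=` U by move=> x /hi/VU.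
  by rewrite !(res_comp _ _ hW).
- rewrite -(uu s) // -(uu t) // => i; by have [_ ->] := svalP (projT2 (hI i)).
Qed.

Lemma sec_empty U (s t : E U) : (forall x, ~ U x) -> s = t.
Proof. by move=> U0; apply: sec_sep => x /U0. Qed.

(** Over a disjoint cover the gluing condition is empty. This turns a section given near one point
    of the partial normalization into a section of [E], although other points may lie over the same
    point of [X]. *)
Lemma extend_zero U V W (VU : V `<=` U) (WU : W `<=` U) (s : E V) :
  U `<=` V `|` W -> (forall x, V x -> ~ W x) ->
  exists t : E U, res E VU t = s /\ res E WU t = 0.
Proof.
move=> cov disj; pose Z (b : bool) := if b then V else W.
have ZU b : Z b `<=` U by case: b.
pose sZ (b : bool) : E (Z b) := if b as b return E (Z b) then s else 0.
have [||t [tP _]] := @sheaf_glue R Y E U bool Z ZU sZ.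
- by move=> x /cov[Vx|Wx]; [exists true|exists false].
- move=> [] [] A hi hj; rewrite /sZ /=; try exact: res_irr.
  + by apply: sec_empty => x Ax; apply: (disj x (hi x Ax) (hj x Ax)).
  + by apply: sec_empty => x Ax; apply: (disj x (hj x Ax) (hi x Ax)).
- exists t; split; first by rewrite (res_irr VU (ZU true)) (tP true).
  by rewrite (res_irr WU (ZU false)) (tP false).
Qed.

Lemma frame1_ex U (e : E U) V (VU : V `<=` U) (s : E V) : frame1 e ->
  exists2 f, regular V f & s = act E f (res E VU e).
Proof.
move=> /(_ V VU s)[f [hf -> _]]; exists (f ord0) => //.
by rewrite /lincomb big_ord1.
Qed.

Lemma frame1_eq U (e : E U) V (VU : V `<=` U) f g : frame1 e ->
  regular V f -> regular V g -> act E f (res E VU e) = act E g (res E VU e) ->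
  forall x, V x -> f x = g x.
Proof.
move=> he hf hg fg x Vx.
have [a [ha aE aU]] := he V VU (act E f (res E VU e)).
have -> := aU (fun=> f) _ _ ord0 x Vx; rewrite /lincomb ?big_ord1 //.
by have -> := aU (fun=> g) _ _ ord0 x Vx; rewrite /lincomb ?big_ord1.
Qed.

Lemma frame1_eq0 U (e : E U) V (VU : V `<=` U) f : frame1 e -> regular V (fun=> 0) ->
  regular V f -> act E f (res E VU e) = 0 -> forall x, V x -> f x = 0.
Proof.
move=> he h0 hf fe; apply: (frame1_eq he hf h0); rewrite fe act_0 //.
Qed.

Lemma frame1S U (e : E U) V (VU : V `<=` U) : frame1 e -> frame1 (res E VU e).
Proof.
move=> he W WV s; have WU : W `<=` U by move=> x /WV/VU.
have [f [hf -> fU]] := he W WU s; exists f; split=> //.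
  by rewrite /lincomb !big_ord1 (res_comp _ _ WU).
by move=> g hg; rewrite /lincomb !big_ord1 (res_comp _ _ WU) => gE;
  apply: fU; rewrite // /lincomb !big_ord1.
Qed.

Lemma frame_frame1 U (e : 'I_1 -> E U) : frame e -> frame1 (e ord0).
Proof.
by rewrite /frame1; congr (frame _); apply/funext => i; rewrite ord1.
Qed.
End Sheaf.

Section Hom.
Variables (R : realType) (Y : space R) (E F : sheaf Y) (h : hom E F).

Lemma hom0 U : h U 0 = 0.
Proof. by apply: (addrI (h U 0)); rewrite -homD !addr0. Qed.
Lemma homN U s : h U (- s) = - h U s.
Proof. by apply: (addrI (h U s)); rewrite -homD !subrr hom0. Qed.
Lemma homB U s t : h U (s - t) = h U s - h U t.
Proof. by rewrite homD homN. Qed.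
Lemma hom_sum U (I : finType) (P : pred I) (s : I -> E U) :
  h U (\sum_(i | P i) s i) = \sum_(i | P i) h U (s i).
Proof. by apply: (big_morph (h U)); [move=> *; exact: homD|exact: hom0]. Qed.
End Hom.

Section Subsheaf.
Variables (R : realType) (Y : space R) (E : sheaf Y) (S : subsheaf E).
Implicit Types U V W : opens Y.

Lemma mem_local U (s : E U) :
  (forall x, U x -> exists V (VU : V `<=` U), V x /\ S V (res E VU s)) -> S U s.
Proof.
move=> h; pose I := {x | U x}.
have hI (i : I) : {V : opens Y & {VU : V `<=` U | V (sval i) /\ S V (res E VU s)}}.
  by have [V hV] := cid (h _ (svalP i)); exists V; exact: cid hV.
apply: (@mem_glue _ _ _ S U I (fun i => projT1 (hI i)) (fun i => sval (projT2 (hI i)))).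
- by move=> x Ux; exists (exist _ x Ux) => //; have [] := svalP (projT2 (hI (exist _ x Ux))).
- by move=> i; have [] := svalP (projT2 (hI i)).
Qed.

Lemma val_act U f (s : subsec S U) : regular U f ->
  val (act (sheaf_of_sub S) f s) = act E f (val s).
Proof.
move=> hf /=; case: pselect => //= h; case: h.
by apply: mem_act => //; exact: subsecP.
Qed.

Lemma val_lincomb r U V (VU : V `<=` U) f (e : 'I_r -> subsec S U) :
  (forall i, regular V (f i)) ->
  val (lincomb (E := sheaf_of_sub S) VU f e) = \sum_i act E (f i) (res E VU (val (e i))).
Proof.
move=> hf; rewrite /lincomb.
rewrite (big_morph (fun s : subsec S V => val s) (id1 := 0) (op1 := +%R)) //.
by apply: eq_bigr => i _; rewrite (val_act _ (hf i)).
Qed.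
End Subsheaf.

(** * Local equations on a smooth curve *)

Section ProjectiveSeparation.
Variables (R : realType) (N : nat).
Local Notation C := (R[i]).

(** Vanishing minors make the vectors proportional; a first nonzero coordinate equal to 1 then
    forces the same pivot and the factor 1. *)
Lemma normalized_eq (x y : 'rV[C]_N.+1) : normalized x -> normalized y ->
  (forall i j, x 0 i * y 0 j = x 0 j * y 0 i) -> x = y.
Proof.
move=> /existsP[i /andP[/eqP xi /forallP xl]] /existsP[i' /andP[/eqP yi /forallP yl]] xy.
have := xy i i'; rewrite xi yi mul1r => /esym/eqP e.
have [le_ii'|lt_i'i|eii'] := ltngtP i i'.
- have /implyP/(_ le_ii')/eqP y0 := yl i.
  by rewrite y0 mulr0 eq_sym oner_eq0 in e.
- have /implyP/(_ lt_i'i)/eqP x0 := xl i'.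
  by rewrite x0 mul0r eq_sym oner_eq0 in e.
apply/rowP => j; have := xy i j; rewrite xi mul1r => ->.
by have -> : i = i' by [exact: val_inj]; rewrite yi mulr1.
Qed.

(** Linear forms whose common zero locus is the single point [p]; they separate the points of a
    curve. *)
Definition minor (p : proj_pt R N) (i j : 'I_N.+1) : mpoly N.+1 C :=
  val p 0 j *: mpolyX C (mnm1 i) - val p 0 i *: mpolyX C (mnm1 j).

Lemma homogX (i : 'I_N.+1) : homog 1 (mpolyX C (mnm1 i)).
Proof. by rewrite /homog dhomogX /= mdeg1. Qed.

Lemma minor_homog p i j : homog 1 (minor p i j).
Proof. by apply: rpredB; apply: homogZ; exact: homogX. Qed.

Lemma pval_minor p i j (x : proj_pt R N) :
  pval (minor p i j) x = val p 0 j * val x 0 i - val p 0 i * val x 0 j.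
Proof. by rewrite /pval /minor mevalB !mevalZ !mevalXU. Qed.

Lemma pval_minor_id p i j : pval (minor p i j) p = 0.
Proof. by rewrite pval_minor mulrC subrr. Qed.

Lemma minor_eq (p x : proj_pt R N) : (forall i j, pval (minor p i j) x = 0) -> x = p.
Proof.
move=> h; apply: val_inj; apply: normalized_eq; [exact: valP|exact: valP|] => i j.
have /eqP := h i j; rewrite pval_minor subr_eq0 => /eqP.
by rewrite mulrC => ->; rewrite mulrC.
Qed.
End ProjectiveSeparation.

Lemma near_forall (T : topologicalType) (x : T) (I : finType) (A : I -> T -> Prop) :
  (forall i, \forall y \near x, A i y) -> \forall y \near x, forall i, A i y.
Proof. by move=> h; exact: filter_forall h. Qed.

Section CurvePoints.
Variables (R : realType) (X : curve R).
Local Notation C := (R[i]).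
Let aX := curve_alg_germs X.
Implicit Types (p : X) (U V W : opens X).

Lemma near_open U p : U p -> \forall x \near p, U x.
Proof. by move=> Up; apply: open_nbhs_nbhs; split=> //; exact: ocarP. Qed.

Lemma near_opens p (A : set X) : (\forall x \near p, A x) -> exists2 U : opens X, U p & U `<=` A.
Proof.
by move=> h; have : nbhs p A := h; rewrite nbhsE => -[U [oU Up] UA]; exists (Opens oU).
Qed.

Lemma open_cofinite (A : set X) : open A -> A !=set0 -> finite_set (~` A).
Proof.
move=> oA [x Ax]; apply: curve_dim1; first exact: open_closedC.
by move=> e; have : (~` A) x by [rewrite e]; exact.
Qed.

(** Irreducibility: two disjoint nonempty opens would have finite complements covering the infinite
    set [X]. *)
Lemma open_meet (A B : set X) : open A -> open B -> A !=set0 -> B !=set0 ->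
  (A `&` B) !=set0.
Proof.
move=> oA oB A0 B0; apply: contrapT => /set0P/negP/negPn/eqP AB.
apply: (@curve_infinite R X); rewrite -setC0 -AB setCI finite_setU.
by split; exact: open_cofinite.
Qed.

Lemma curve_point : exists p : X, True.
Proof.
apply: contrapT => h; apply: (@curve_infinite R X).
by rewrite (_ : setT = set0) //; apply/seteqP; split=> // p _; apply: h; exists p.
Qed.

Lemma not_isolated p (A : set X) : (\forall x \near p, A x) -> exists2 x, A x & x != p.
Proof.
move=> /near_opens[U Up UA]; apply: contrapT => h.
have U1 : U `<=` [set p].
  by move=> x Ux; apply/eqP/negPn/negP => xp; apply: h; exists x => //; exact: UA.
apply: (@curve_infinite R X); rewrite -(setUv (U : set X)) finite_setU; split.
  exact: sub_finite_set U1 (finite_set1 p).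
by apply: open_cofinite; [exact: ocarP|exists p].
Qed.

(** This replaces continuity: a nonzero value would persist on a neighbourhood, which contains a
    point other than [p]. *)
Lemma reg_vanish p f : reg p f -> (\forall y \near p, y != p -> f y = 0) -> f p = 0.
Proof.
move=> hf f0; apply/eqP/negPn/negP => /(ag_near aX hf) fn.
have [x [fx0 fx] xp] := not_isolated (filterI f0 fn).
by move: fx; rewrite fx0 ?eqxx.
Qed.

Lemma curve_pt_eq (p q : X) : (forall i j, pval (minor (sub_incl p) i j) (sub_incl q) = 0) -> q = p.
Proof. by move=> /minor_eq; exact: val_inj. Qed.

Lemma curve_accessible : accessible_space X.
Proof.
move=> p q pq.
have [i [j hij]] : exists i j, pval (minor (sub_incl q) i j) (sub_incl p) != 0.
  apply: contrapT => h; move/eqP: pq; apply; apply: curve_pt_eq => i j.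
  by apply/eqP/negPn/negP => hij; apply: h; exists i, j.
have oA : open [set x : X | pval (minor (sub_incl q) i j) (sub_incl x) != 0].
  exists [set x | pval (minor (sub_incl q) i j) x != 0] => //.
  by move=> x hx; exists 1%N, (minor (sub_incl q) i j); split=> //; exact: minor_homog.
eexists; split; [exact: oA|by rewrite inE|].
by rewrite inE /= pval_minor_id eqxx.
Qed.

(** If the nonvanishing locus of [t] is nonempty, its complement is finite, and removing [p] leaves
    a closed set. The remaining case, that the generator of the maximal ideal is the zero germ, has
    to be excluded. *)
Lemma uniformizer_near p t : uniformizer p t -> \forall y \near p, y != p -> t y != 0.
Proof.
move=> [ht tp0 ht0]; have [U Up Ut] := near_opens (ag_open aX ht).
pose A := [set x | U x /\ t x != 0].
have oA : open A.
  rewrite openE => x [Ux tx]; apply: filterI; first exact: near_open.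
  by apply: (ag_near aX) => //; exact: Ut.
have [A0|A0] := pselect (A !=set0).
  have cF : closed ((~` A) `\ p).
    have [h _] := @accessible_finite_set_closed X; apply: (h (@curve_accessible)).
    exact: sub_finite_set (@subDsetl _ _ _) (open_cofinite oA A0).
  have : \forall y \near p, (~` ((~` A) `\ p)) y.
    apply: open_nbhs_nbhs; split; first exact: (closed_openC cF).
    by move=> [_]; apply.
  apply: filterS => y h yp; apply: contrapT => ty; apply: h; split; first by case.
  by move=> e; rewrite e eqxx in yp.
(* If [t] vanished near [p], so would every regular germ vanishing at [p]. For the quotients of
   [minor] by a coordinate nonzero at [p], this would make [p] isolated. *)
exfalso; have t0 : \forall y \near p, t y = 0.
  apply: filterS (near_open Up) => y Uy; apply/eqP/negPn/negP => ty.
  by apply: A0; exists y.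
have /existsP[i0 /andP[/eqP pi0 _]] := valP (sub_incl p).
have x0 : \forall y \near p, (fun y : X => pval (mpolyX C (mnm1 i0)) (sub_incl y) != 0) y.
  apply: (@near_sub _ _ _ p (fun y => pval (mpolyX C (mnm1 i0)) y != 0)).
  apply: (@proj_nonzero _ _ (sub_incl p) _ _ (homogX R i0)).
  by rewrite /pval mevalXU pi0 oner_eq0.
have hm (ij : 'I_(cdim X).+1 * 'I_(cdim X).+1) :
    \forall y \near p, (fun y : X => pval (minor (sub_incl p) ij.1 ij.2) (sub_incl y) = 0) y.
  pose g (y : proj R (cdim X)) :=
    pval (minor (sub_incl p) ij.1 ij.2) y / pval (mpolyX C (mnm1 i0)) y.
  have rg : reg p (fun y : X => g (sub_incl y)).
    exists g; last exact: (filterE (F := nbhs p)).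
    exists 1%N, (minor (sub_incl p) ij.1 ij.2), (mpolyX C (mnm1 i0)); split.
    + exact: minor_homog.
    + exact: (homogX R i0).
    + exact: near_here x0.
    + exact: (filterE (F := nbhs _)).
  have gp : g (sub_incl p) = 0 by rewrite /g pval_minor_id mul0r.
  have [u _ uE] := ht0 _ rg gp.
  apply: filterS2 (filterI uE t0) x0 => y [/= gE ty] xy; move: gE.
  rewrite ty mul0r => /eqP; rewrite mulf_eq0 invr_eq0 (negPf xy) orbF.
  by move/eqP.
have {}hm : \forall y \near p, (fun y : X => forall ij : 'I_(cdim X).+1 * 'I_(cdim X).+1,
    pval (minor (sub_incl p) ij.1 ij.2) (sub_incl y) = 0) y by exact: near_forall hm.
have [x xE /eqP] := not_isolated hm; apply.
by apply: curve_pt_eq => i j; exact: (xE (i, j)).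
Qed.

Lemma regular_cst (U : set X) c : regular U (fun=> c).
Proof. by move=> x _; exact: ag_cst. Qed.

Lemma regularD (U : set X) f g : regular U f -> regular U g -> regular U (fun x => f x + g x).
Proof. by move=> hf hg x Ux; apply: (ag_add aX); [exact: hf|exact: hg]. Qed.

Lemma regularM (U : set X) f g : regular U f -> regular U g -> regular U (fun x => f x * g x).
Proof. by move=> hf hg x Ux; apply: (ag_mul aX); [exact: hf|exact: hg]. Qed.

Lemma regularN (U : set X) f : regular U f -> regular U (fun x => - f x).
Proof.
move=> hf x Ux; apply: (ag_germ aX (f := fun x => -1 * f x)).
  by apply: (filterE (F := nbhs x)) => y; rewrite mulN1r.
by apply: (ag_mul aX); [exact: ag_cst|exact: hf].
Qed.

Lemma regularB (U : set X) f g : regular U f -> regular U g -> regular U (fun x => f x - g x).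
Proof. by move=> hf hg; apply: regularD => //; exact: regularN. Qed.

Lemma regular_sum (U : set X) n (f : 'I_n -> X -> C) : (forall i, regular U (f i)) ->
  regular U (fun x => \sum_i f i x).
Proof. by move=> hf x Ux; apply: reg_sum => i; exact: hf. Qed.

Lemma divide_uniformizer (W : opens X) p c f : regular W c -> regular W f ->
  (forall x, W x -> x != p -> c x != 0) ->
  (W p -> c p = 0 -> uniformizer p c /\ f p = 0) ->
  exists2 u, regular W u & forall x, W x -> f x = c x * u x.
Proof.
move=> hc hf cn hp; have [[Wp c0]|Wp] := pselect (W p /\ c p = 0); last first.
  have cn' x : W x -> c x != 0.
    move=> Wx; have [xp|xp] := eqVneq x p; last exact: cn.
    by apply/eqP => cx; apply: Wp; rewrite -xp.
  exists (fun x => f x * (c x)^-1) => x Wx.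
    by apply: (ag_mul aX); [exact: hf|apply: (ag_inv aX); [exact: hc|exact: cn']].
  by rewrite mulrCA mulfV ?mulr1 //; exact: cn'.
have [[_ cp cu] fp] := hp Wp c0; have [g hg gE] := cu f (hf p Wp) fp.
(* Off [p] this is the quotient; near [p] it agrees with the regular [g], because [c] can be
   cancelled away from [p] and the value at [p] is prescribed. *)
pose u x := if x == p then g p else f x * (c x)^-1.
exists u => x Wx; rewrite /u; last first.
  have [->|xp] := eqVneq; first by rewrite fp cp mul0r.
  by rewrite mulrCA mulfV ?mulr1 //; exact: cn.
have [->{x Wx}|xp] := eqVneq x p.
  apply: (ag_germ aX (f := g)) => //.
  apply: filterS2 gE (near_open Wp) => y -> Wy; case: (eqVneq y p) => [->//|yp].
  by rewrite mulrAC mulfV ?mul1r //; exact: cn.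
apply: (ag_germ aX (f := fun y => f y * (c y)^-1)); last first.
  by apply: (ag_mul aX); [exact: hf|apply: (ag_inv aX); [exact: hc|exact: cn]].
have : \forall y \near x, (~` [set p]) y.
  apply: open_nbhs_nbhs; split; last by move=> e; rewrite e eqxx in xp.
  by apply: closed_openC; apply: accessible_closed_set1; exact: curve_accessible.
by apply: filterS => y /eqP/negPf->.
Qed.

(** In the frame [e] the coefficient of [s] vanishes where [c] does not, hence off [p], and then at
    [p] by [reg_vanish]. *)
Lemma torsion_free (N : sheaf X) V (e : N V) W (WV : W `<=` V) p c (s : N W) :
  frame1 e -> regular W c -> (forall x, W x -> x != p -> c x != 0) ->
  act N c s = 0 -> s = 0.
Proof.
move=> he hc cn cs; have [f hf sE] := frame1_ex WV s he.
rewrite sE -actM // in cs.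
have cf0 := frame1_eq0 he (@regular_cst W 0) (regularM hc hf) cs.
have f0 x : W x -> x != p -> f x = 0.
  move=> Wx xp; apply/eqP; move/eqP: (cf0 x Wx); rewrite mulf_eq0.
  by rewrite (negPf (cn x Wx xp)).
rewrite sE act_0 //; first exact: regular_cst.
move=> x Wx; have [xp|] := eqVneq x p; last exact: f0.
apply: reg_vanish; first exact: hf.
by apply: filterS (near_open Wx) => y Wy; rewrite {1}xp; exact: f0.
Qed.
End CurvePoints.

Section Coefficient.
Variables (R : realType) (X : curve R) (K : line_bundle X).
Implicit Types U V W : opens X.

Lemma coefficient_ex U (k : K U) (a : K (otop X)) : frame1 k -> exists c, coefficient k a c.
Proof.
move=> hk; have [f hf fE] := frame1_ex (@subset_refl _ _) (res K (@sub_otop R X U) a) hk.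
by exists f; split=> //; rewrite fE res_id.
Qed.

Lemma coefficientB U (k : K U) a b c d : coefficient k a c -> coefficient k b d ->
  coefficient k (a - b) (fun x => c x - d x).
Proof.
move=> [hc cE] [hd dE]; have hcd := regularB hc hd.
split=> //; rewrite res_B cE dE act_lB //; exact: regular_cst.
Qed.

Lemma frame1_cover (p : X) : exists2 U : opens X, U p & exists k : K U, frame1 k.
Proof.
have [U [Up [e he]]] := lb_free K p; exists U => //.
by exists (e ord0); exact: frame_frame1.
Qed.
End Coefficient.

(** * Filtrations with prescribed graded pieces *)

Section Flag.
Variables (R : realType) (X : curve R) (K : line_bundle X) (r : nat) (E : higgs K).
Variables (N : 'I_r -> sheaf X) (rho : forall i, hom E (N i)).
Variables (a : 'I_r -> K (otop X)) (D : 'I_r -> X -> nat) (below : rel 'I_r).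
Implicit Types U V W : opens X.
Local Notation C := (R[i]).

(* e lifts a generator of N_i(- D_i) to E.  The components l with ~~ below l i, on which e is
   required to vanish, include all l > i; in the application to a reduction to a product of
   Borel groups, also those in other connected components. *)
Definition flag_section (i : 'I_r) V (e : E V) : Prop :=
  [/\ forall l, ~~ below l i -> rho l V e = 0,
      forall W (WV : W `<=` V) (s : E W), (forall l : 'I_r, (i < l)%N -> rho l W s = 0) ->
        exists2 u, regular W u & rho i W s = act (N i) u (rho i W (res E WV e)),
      forall W (WV : W `<=` V) (t : N i W), twist (N i) (D i) W t ->
        exists2 u, regular W u & t = act (N i) u (rho i W (res E WV e)),
      twist (N i) (D i) V (rho i V e)
    & forall W (WV : W `<=` V) u, regular W u -> act (N i) u (rho i W (res E WV e)) = 0 ->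
        forall x, W x -> u x = 0].

Lemma flag_sectionS i V W (WV : W `<=` V) (e : E V) :
  flag_section i e -> flag_section i (res E WV e).
Proof.
move=> [e0 eu et em ei]; split.
- by move=> l li; rewrite hom_res e0 // res_0.
- move=> W' WW s hs; have WV' : W' `<=` V by move=> x /WW/WV.
  by rewrite (res_comp WV WW WV'); exact: eu.
- move=> W' WW s hs; have WV' : W' `<=` V by move=> x /WW/WV.
  by rewrite (res_comp WV WW WV'); exact: et.
- by rewrite hom_res; exact: mem_res.
- move=> W' WW u hu; have WV' : W' `<=` V by move=> x /WW/WV.
  by rewrite (res_comp WV WW WV'); exact: ei.
Qed.

Lemma flag_section_all (p : X) :
  (forall i, exists V, V p /\ exists e : E V, flag_section i e) ->
  exists V, V p /\ exists e : 'I_r -> E V, forall i, flag_section i (e i).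
Proof.
move=> h; have {}h i : {V : opens X & V p /\ exists e : E V, flag_section i e}.
  exact: cid.
have : \forall x \near p, forall i, projT1 (h i) x.
  have hn i : \forall x \near p, projT1 (h i) x by apply: near_open; exact: (projT2 (h i)).1.
  exact: near_forall hn.
move=> /near_opens[V Vp Vh]; exists V; split=> //.
have Vi i : V `<=` projT1 (h i) by move=> x Vx; exact: Vh Vx i.
pose e i := cid (projT2 (h i)).2.
exists (fun i => res E (Vi i) (projT1 (e i))) => i.
by apply: flag_sectionS; exact: projT2 (e i).
Qed.

Hypothesis below_le : forall i j, below i j -> (i <= j)%N.
Hypothesis rho_inj : forall U (s : E U), (forall i, rho i U s = 0) -> s = 0.

Section Frame.
Variables (V : opens X) (e : 'I_r -> E V).
Hypothesis he : forall i, flag_section i (e i).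

(** Elimination from the top index: the second clause of [flag_section] gives the multiple of a
    section to subtract, and what all [rho i] kill is zero. Coefficients of index at least [m] are
    the zero function itself, so that sums narrow to the first [m] indices. *)
Lemma flag_expand m W (WV : W `<=` V) (s : E W) :
  (forall l : 'I_r, (m <= l)%N -> rho l W s = 0) ->
  exists f : 'I_r -> X -> C, [/\ forall i, regular W (f i),
    forall i : 'I_r, (m <= i)%N -> f i = fun=> 0
    & s = lincomb WV f e].
Proof.
have r0 : regular W (fun=> 0 : C) by exact: regular_cst.
elim: m s => [|m IH] s hs.
  exists (fun _ _ => 0); split=> //; rewrite [LHS]rho_inj; last by move=> i; exact: hs.
  by rewrite /lincomb big1 // => i _; rewrite act_0.
have [mr|rm] := ltnP m r; last first.
  have [|f [hf f0 sE]] := IH s.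
    by move=> l ml; have := leq_trans (leq_trans (ltn_ord l) rm) ml; rewrite ltnn.
  by exists f; split=> // i mi; apply: f0; exact: ltnW.
pose m' := Ordinal mr; have [e0 eu _ _ _] := he m'.
have [u hu uE] := eu W WV s hs.
have [|f [hf f0 sE]] := IH (s - act E u (res E WV (e m'))).
  move=> l; rewrite leq_eqVlt => /orP[/eqP ml|ml].
    have -> : l = m' by exact: val_inj.
    by rewrite homB hom_act // uE subrr.
  rewrite homB hs // hom_act // hom_res e0 ?res_0 ?act_r0 ?subr0 //.
  by apply/negP => /below_le; rewrite leqNgt ml.
exists (fun i => if i == m' then u else f i); split.
- by move=> i; case: eqP.
- move=> i mi; case: eqP => [im|_]; last by apply: f0; exact: ltnW.
  by move: mi; rewrite im ltnn.
- move/eqP: sE; rewrite subr_eq => /eqP->; rewrite /lincomb (bigD1 m') //=.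
  rewrite [in RHS](bigD1 m') //= eqxx f0 // act_0 // add0r addrC.
  by congr (_ + _); apply: eq_bigr => i /negPf->.
Qed.

(** [rho i] kills [e j] unless [below i j], so it sees only indices from [i] upwards; outside the
    lower set [B] the coefficients vanish one by one from the top. The empty [B] gives uniqueness of
    coefficients, the lower set of one index gives triangularity. *)
Lemma flag_coef0 (B : pred 'I_r) W (WV : W `<=` V) f (s : E W) :
  (forall i l, B i -> below l i -> B l) -> (forall i, regular W (f i)) ->
  s = lincomb WV f e -> (forall l, ~~ B l -> rho l W s = 0) ->
  forall i, ~~ B i -> forall x, W x -> f i x = 0.
Proof.
move=> hB hf sE s0.
have r0 : regular W (fun=> 0 : C) by exact: regular_cst.
suff h k (i : 'I_r) : (r - i <= k)%N -> ~~ B i -> forall x, W x -> f i x = 0.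
  by move=> i; exact: h (leqnn _).
elim: k i => [|k IH] i; first by rewrite leqn0 subn_eq0 leqNgt ltn_ord.
move=> ik Bi; have [_ _ _ _] := he i; apply; first exact: hf.
have := s0 i Bi; rewrite sE hom_sum (bigD1 i) //= hom_act // big1 ?addr0 //.
move=> j ji; rewrite hom_act //; have [ij|ij] := boolP (below i j); last first.
  by have [e0 _ _ _ _] := he j; rewrite hom_res e0 // res_0 act_r0.
have lij : (i < j)%N by rewrite ltn_neqAle below_le // andbT eq_sym.
rewrite act_0 //; apply: IH.
  by rewrite -ltnS; apply: leq_trans ik; apply: ltn_sub2l; rewrite ?ltn_ord.
by apply: contra Bi => Bj; exact: hB ij.
Qed.

Lemma flag_coef_eq W (WV : W `<=` V) f g : (forall i, regular W (f i)) ->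
  (forall i, regular W (g i)) -> lincomb WV f e = lincomb WV g e ->
  forall i x, W x -> f i x = g i x.
Proof.
move=> hf hg fg i x Wx; apply/eqP; rewrite -subr_eq0; apply/eqP.
have r0 : regular W (fun=> 0 : C) by exact: regular_cst.
have hfg j : regular W (fun x => f j x - g j x) by exact: regularB.
apply: (@flag_coef0 pred0 W WV (fun j x => f j x - g j x) 0) => //.
  apply/esym; transitivity (lincomb WV f e - lincomb WV g e); last by rewrite fg subrr.
  by rewrite /lincomb -sumrB; apply: eq_bigr => j _; rewrite act_lB.
by move=> l _; rewrite hom0.
Qed.

Lemma flag_frame : frame e.
Proof.
move=> W WV s; have [|f [hf _ sE]] := @flag_expand r W WV s.
  by move=> l; rewrite leqNgt ltn_ord.
exists f; split=> // g hg gE i y Wy; apply: (flag_coef_eq (WV := WV)) => //.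
by rewrite -gE.
Qed.
End Frame.

Hypothesis rho_phi : forall i U (k : K U) c (s : E U), frame1 k -> coefficient k (a i) c ->
  rho i U (phi k s) = act (N i) c (rho i U s).
Hypothesis flag_local : forall p : X, exists V, V p /\ exists e : 'I_r -> E V, forall i, flag_section i (e i).

Section Step.
Variable m : nat.

Let fmem U (s : E U) := forall l : 'I_r, (m <= l)%N -> rho l U s = 0.

Definition flag_sub : subsheaf E.
Proof.
refine (@Subsheaf R X E fmem _ _ _ _ _).
- by move=> U l _; rewrite hom0.
- by move=> U s t hs ht l ml; rewrite homB hs // ht // subr0.
- by move=> U f s hf hs l ml; rewrite hom_act // hs // act_r0.
- by move=> U V h s hs l ml; rewrite hom_res hs // res_0.
- move=> U I V h s cov hs l ml; apply: sec_sep => x /cov[i _ Vx].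
  by exists (V i), (h i); split=> //; rewrite -hom_res hs // res_0.
Defined.

Lemma flag_sub_phi U (k : K U) (s : E U) : frame1 k -> flag_sub U s -> flag_sub U (phi k s).
Proof.
move=> hk hs /= l ml; have [c hc] := coefficient_ex (a l) hk.
by rewrite (rho_phi _ hk hc) hs // act_r0 //; case: hc.
Qed.

Definition flag : subhiggs E := Subhiggs flag_sub_phi.
End Step.

Lemma flag_rho m U (s : E U) (l : 'I_r) : flag m U s -> (m <= l)%N -> rho l U s = 0.
Proof. by move=> /= hs; exact: hs. Qed.

Lemma flag_bot U (s : E U) : flag 0 U s <-> s = 0.
Proof.
split=> [hs|->]; first by apply: rho_inj => i; exact: hs.
by move=> /= l _; rewrite hom0.
Qed.

Lemma flag_top U (s : E U) : flag r U s.
Proof. by move=> /= l; rewrite leqNgt ltn_ord. Qed.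

Lemma flag_sec V (e : 'I_r -> E V) (i : 'I_r) m : (i < m)%N -> flag_section i (e i) ->
  flag m V (e i).
Proof.
move=> im [e0 _ _ _ _] /= l ml; apply: e0; apply/negP => /below_le.
by rewrite leqNgt (leq_trans im ml).
Qed.

Lemma flag_free m : (m <= r)%N -> locally_free (sheaf_of_sub (flag m)) m.
Proof.
move=> mr p; have [V [Vp [e he]]] := flag_local p.
pose w := widen_ord mr.
have we i : flag m V (e (w i)) by apply: flag_sec => //=; exact: ltn_ord.
have narrow W (WV : W `<=` V) f : (forall i : 'I_r, (m <= i)%N -> f i = fun=> 0) ->
    lincomb WV f e = \sum_i act E (f (w i)) (res E WV (e (w i))).
  move=> f0; rewrite /lincomb (bigID (fun i : 'I_r => (i < m)%N)) /= [X in _ + X]big1 ?addr0.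
    by rewrite big_ord_narrow.
  by move=> i; rewrite -leqNgt => /f0->; rewrite act_0 //; exact: regular_cst.
exists V; split=> //; exists (fun i => mk_subsec (we i)) => W WV s.
have [f [hf f0 sE]] := flag_expand he WV (subsecP s).
exists (f \o w); split; first by move=> i; exact: hf.
  by apply: subsec_inj; rewrite val_lincomb /= -?narrow // => i; exact: hf.
move=> g hg /(congr1 (fun s : subsec _ _ => val s)); rewrite val_lincomb //= => sE'.
(* Coefficients on the first [m] sections are extended by 0, so that their uniqueness follows from
   that for the whole frame. *)
pose g' (i : 'I_r) := if insub (i : nat) is Some j then g j else fun=> 0.
have g'w j : g' (w j) = g j by rewrite /g' (valK (j : 'I_m)).
move=> i y Wy; rewrite -g'w /=; apply: (flag_coef_eq he (WV := WV)) => //.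
- by move=> j; rewrite /g'; case: insubP => // _; exact: regular_cst.
- apply: etrans sE; apply: etrans (esym sE'); rewrite narrow; first by apply: eq_bigr => j _; rewrite g'w.
  by move=> j mj; rewrite /g' insubF // ltnNge mj.
Qed.

Lemma flag_twist (i : 'I_r) U (s : E U) : flag i.+1 U s -> twist (N i) (D i) U (rho i U s).
Proof.
move=> hs; apply: mem_local => x Ux; have [V [Vx [e he]]] := flag_local x.
have WV : omeet U V `<=` V by move=> y [].
have WU : omeet U V `<=` U by move=> y [].
exists (omeet U V), WU; split=> //; have [_ eu _ et _] := he i.
rewrite -hom_res; have [l il|u hu ->] := eu _ WV (res E WU s).
  by rewrite hom_res (flag_rho hs) // res_0.
by apply: mem_act => //; rewrite hom_res; exact: mem_res.
Qed.

(** The isomorphism is induced by [rho i], whose kernel on step [i + 1] is step [i]; it is onto the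
    twist because local lifts are multiples of [e i]. *)
Lemma flag_quotient (i : 'I_r) : quotient_iso (flag i.+1) (flag i)
  (sheaf_of_sub (twist (N i) (D i))) (a i).
Proof.
split; first by move=> U s hs /= l il; apply: (flag_rho hs); exact: ltnW.
pose h U (s : subsec (flag i.+1) U) : subsec (twist (N i) (D i)) U :=
  mk_subsec (flag_twist (subsecP s)).
unshelve eexists (@Hom _ _ (sheaf_of_sub (flag i.+1)) (sheaf_of_sub (twist (N i) (D i))) h _ _ _).
- by move=> U s t; apply: subsec_inj => /=; rewrite homD.
- move=> U f s hf; apply: subsec_inj; apply: etrans (esym (val_act (h U s) hf)) => /=.
  by rewrite -hom_act //; congr (rho i U _); exact: val_act.
- by move=> U V VU s; apply: subsec_inj => /=; rewrite hom_res.
split=> /=.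
- move=> U t x Ux; have [V [Vx [e he]]] := flag_local x.
  have WV : omeet U V `<=` V by move=> y [].
  have WU : omeet U V `<=` U by move=> y [].
  exists (omeet U V), WU; split=> //; have [_ _ et _ _] := he i.
  have [u hu uE] := et _ WV (res (N i) WU (val t)) (mem_res WU (subsecP t)).
  have hs : flag i.+1 (omeet U V) (act E u (res E WV (e i))).
    by apply: mem_act => //; apply: mem_res; exact: flag_sec.
  exists (mk_subsec hs); apply: subsec_inj => /=.
  by rewrite hom_act // uE.
- move=> U s; split=> [/(congr1 val) /= s0 /= l|s0].
    rewrite leq_eqVlt => /orP[/eqP il|il]; last exact: (flag_rho (subsecP s)).
    by have <- : i = l by exact: val_inj.
  by apply: subsec_inj => /=; exact: (flag_rho s0).
- move=> U k c s t hk hc tE; apply: subsec_inj.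
  apply/esym; apply: etrans (val_act (mk_subsec (flag_twist (subsecP s))) hc.1) _ => /=.
  by rewrite -(rho_phi _ hk hc); congr (rho i U _); rewrite -tE.
Qed.

Lemma flag_strict (i : 'I_r) : exists U (s : E U), flag i.+1 U s /\ ~ flag i U s.
Proof.
have [p _] := curve_point X.
have [V [Vp [e he]]] := flag_local p; exists V, (e i); split; first exact: flag_sec.
(* If [rho i] killed [e i], the last clause of [flag_section] would make the constant coefficient 1
   vanish at [p]. *)
move=> /flag_rho/(_ (leqnn i)) ei; have [_ _ _ _ et] := he i.
have /eqP : (fun=> 1 : C) p = 0.
  by apply: (et V (@subset_refl _ _)) Vp; [exact: regular_cst|rewrite act1 res_id].
by rewrite oner_eq0.
Qed.
End Flag.

(** * Torsion-freeness and twists by divisors *)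

Section Torsion.
Variables (R : realType) (X : curve R).
Implicit Types U V W : opens X.

Lemma torsion_free_local (N : sheaf X) U c (s : N U) : locally_free N 1 -> regular U c ->
  (forall p, U p -> \forall x \near p, x != p -> c x != 0) -> act N c s = 0 -> s = 0.
Proof.
move=> hN hc cn cs; apply: sec_sep => p Up.
have [V [Vp [e /frame_frame1 he]]] := hN p.
have [V' V'p cV'] := near_opens (cn p Up).
have WU : omeet U (omeet V V') `<=` U by move=> y [].
have WV : omeet U (omeet V V') `<=` V by move=> y [_ []].
exists (omeet U (omeet V V')), WU; split; first by split.
rewrite res_0; apply: (@torsion_free _ _ _ _ _ _ WV p c _ he).
- exact: regularS hc.
- by move=> x [_ [_ /cV']].
- by rewrite -res_act // cs res_0.
Qed.

(** Where the two coefficients agree, [in_Vnod] makes their difference a uniformizer, which has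
    isolated zeros; elsewhere the difference is nonzero nearby. *)
Lemma coefficient_diff_near (K : line_bundle X) n (alpha : 'I_n -> K (otop X)) U (k : K U) j l c d p :
  in_Vnod alpha -> j != l -> frame1 k -> coefficient k (alpha j) c ->
  coefficient k (alpha l) d -> U p -> \forall x \near p, x != p -> c x - d x != 0.
Proof.
move=> [_ hu _] jl hk hc hd Up; have hcd := coefficientB hc hd.
have [cd0|cd0] := eqVneq (c p - d p) 0.
  exact: uniformizer_near (hu _ _ jl _ _ _ _ hk hcd Up cd0).
have h := ag_near (curve_alg_germs X) (hcd.1 _ Up) cd0.
by apply: filterS h.
Qed.
Lemma act_suml (N : sheaf X) U m (f : 'I_m -> X -> R[i]) (s : N U) :
  (forall i, regular U (f i)) ->
  \sum_i act N (f i) s = act N (fun x => \sum_i f i x) s.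
Proof.
elim: m f => [|m IH] f hf.
  rewrite big_ord0 act_0 //; first exact: regular_cst.
  by move=> x _; rewrite big_ord0.
rewrite big_ord_recl IH // -actDl //; first last.
  by apply: regular_sum => i; exact: hf.
by apply: act_ext => x _; rewrite big_ord_recl.
Qed.

(** In the frame [e] the coefficient becomes a sum of multiples of functions in the ideal of [D]. *)
Lemma twist_vanish (N : sheaf X) D V (e : N V) W (WV : W `<=` V) f p : frame1 e ->
  regular W f -> twist N D W (act N f (res N WV e)) -> W p -> (0 < D p)%N -> f p = 0.
Proof.
move=> he hf htw Wp Dp; have [Z [ZW [Zp [m [g [t [hg gE]]]]]]] := htw p Wp.
have ZV : Z `<=` V by move=> x /ZW/WV.
have rg i : regular Z (g i) by exact: in_ideal_reg (hg i).
pose b i := sval (cid2 (frame1_ex ZV (t i) he)).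
have hbr i : regular Z (b i) by rewrite /b; case: cid2.
have bE i : t i = act N (b i) (res N ZV e) by rewrite /b; case: cid2.
move: gE; rewrite res_act // (res_comp _ _ ZV).
under eq_bigr => i _ do rewrite bE -actM //.
rewrite act_suml; last by move=> i; exact: regularM.
have hs : regular Z (fun x => \sum_i g i x * b i x).
  by apply: (@regular_sum _ _ _ _ (fun i x => g i x * b i x)) => i; exact: regularM.
move=> /(frame1_eq he (regularS ZW hf) hs)/(_ p Zp)->.
apply: big1 => i _; have [u [v [[_ u0 _] _ uE]]] := hg i p Zp.
by rewrite (near_here uE) u0 expr0n eqn0Ngt Dp !mul0r.
Qed.

Lemma twist_act (N : sheaf X) D V f (e : N V) : in_ideal D V f -> twist N D V (act N f e).
Proof.
move=> hf /= x Vx; exists V, (@subset_refl _ _); split=> //.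
exists 1%N, (fun=> f), (fun=> e); split=> //.
by rewrite res_id big_ord1.
Qed.
End Torsion.

(** * Uniqueness of the filtration *)

Section FiltrationUnique.
Variables (R : realType) (X : curve R) (K : line_bundle X) (r : nat) (E : higgs K).
Variables (N : 'I_r -> sheaf X) (D : 'I_r -> X -> nat) (a : 'I_r -> K (otop X)).
Implicit Types (U V W : opens X) (F G : nat -> subhiggs E).
Hypothesis hN : forall i, locally_free (N i) 1.
Hypothesis a_diff : forall i j U (k : K U) c d p, i != j -> frame1 k ->
  coefficient k (a i) c -> coefficient k (a j) d -> U p ->
  \forall x \near p, x != p -> c x - d x != 0.

Definition graded F := forall i : 'I_r,
  quotient_iso (F i.+1) (F i) (sheaf_of_sub (twist (N i) (D i))) (a i).

Lemma graded_mono F m m' U (s : E U) : graded F -> (m <= m')%N -> (m' <= r)%N ->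
  F m U s -> F m' U s.
Proof.
move=> gF; elim: m' => [|m' IH]; first by rewrite leqn0 => /eqP->.
rewrite leq_eqVlt => /orP[/eqP->//|mm'] m'r hs.
have [sub _] := gF (Ordinal m'r); apply: sub.
by apply: IH => //; exact: ltnW.
Qed.

(** An ascending induction on [m], meant for use inside a descending one on [i]. The gradings have
    different roles: that of [F] moves phi s - a_m s down to step [m], that of [G] allows a_i - a_m
    to be cancelled on the piece of index [i]. *)
Lemma graded_sub F G (i : 'I_r) : graded F -> graded G ->
  (forall U (s : E U), F 0%N U s -> s = 0) ->
  (forall U (s : E U), F i.+1 U s -> G i.+1 U s) ->
  forall U (s : E U), F i U s -> G i U s.
Proof.
move=> gF gG F0 FG.
suff h m : (m <= i)%N -> forall U (s : E U), F m U s -> G i U s by exact: h.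
elim: m => [_ U s /F0->|m IH mi U s hs]; first exact: mem0.
have mr : (m < r)%N := ltn_trans mi (ltn_ord i).
apply: mem_local => p Up; have [V Vp [k hk]] := frame1_cover K p.
have WU : omeet U V `<=` U by move=> y [].
have WV : omeet U V `<=` V by move=> y [].
exists (omeet U V), WU; split=> //.
set W := omeet U V in WU WV *; set s' := res E WU s.
have hk' := frame1S WV hk; set k' := res K WV k in hk'.
have [c hc] := coefficient_ex (a (Ordinal mr)) hk'.
have [d hd] := coefficient_ex (a i) hk'.
have Fs' : F m.+1 W s' by exact: mem_res.
have Gs' : G i.+1 W s' by apply: FG; apply: graded_mono Fs' => //; exact: ltnW.
have Fp := sh_phi hk' Fs'; have Gp := sh_phi hk' Gs'.
have [_ [hF [_ kF pF]]] := gF (Ordinal mr).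
have [_ [hG [_ kG pG]]] := gG i.
(* [val_t] reads [t] both in step [m + 1] of [F] and in step [i + 1] of [G]. *)
pose t := phi k' s' - act E c s'.
have val_t S (h1 : sh_sub S W (phi k' s')) (h2 : sh_sub S W s') :
    val (mk_subsec h1 - act (sheaf_of_sub S) c (mk_subsec h2) : subsec S W) = t.
  by rewrite raddfB; congr (_ - _); exact: (val_act (mk_subsec h2) hc.1).
have Ft : F m W t.
  rewrite -(val_t _ Fp Fs'); apply/kF.
  by rewrite homB (hom_act _ _ hc.1) (pF _ _ _ (mk_subsec Fs') (mk_subsec Fp) hk' hc) // subrr.
apply/(kG _ (mk_subsec Gs')).
(* In the piece of [G] at [i], the class of [t] is d - c times the class of [s'], and by induction
   it is zero. *)
have /kG : G i W (val (mk_subsec Gp - act (sheaf_of_sub (G i.+1)) c (mk_subsec Gs') : subsec (G i.+1) W)).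
  by rewrite val_t; apply: IH => //; exact: ltnW.
rewrite homB (hom_act _ _ hc.1) (pG _ _ _ (mk_subsec Gs') (mk_subsec Gp) hk' hd) //.
have hdc := regularB hd.1 hc.1.
rewrite -act_lB //; [|exact: regular_cst|exact: hd.1|exact: hc.1].
move=> /(congr1 (fun u : subsec _ _ => val u)) e; apply: subsec_inj.
apply: (@torsion_free_local _ _ _ _ (fun x => d x - c x)) => //.
  move=> q [Uq Vq]; apply: a_diff hk' hd hc _ => //.
  by apply/eqP => im; move: mi; rewrite im ltnn.
exact: etrans (esym (val_act _ hdc)) e.
Qed.

Lemma graded_unique F G : graded F -> graded G ->
  (forall U (s : E U), F 0%N U s -> s = 0) -> (forall U (s : E U), G 0%N U s -> s = 0) ->
  (forall U (s : E U), F r U s) -> (forall U (s : E U), G r U s) ->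
  forall i, (i <= r)%N -> forall U (s : E U), G i U s <-> F i U s.
Proof.
move=> gF gG F0 G0 Fr Gr.
(* Both filtrations end at [E], so the comparison starts at [r] and descends. *)
suff h j : (j <= r)%N -> forall U (s : E U), G (r - j)%N U s <-> F (r - j)%N U s.
  by move=> i ir U s; have := h _ (leq_subr i r) U s; rewrite subKn.
elim: j => [_ U s|j IH jr U s]; first by rewrite subn0.
have lt : (r - j.+1 < r)%N by rewrite ltn_subrL (leq_trans _ jr).
have e : (r - j.+1).+1 = (r - j)%N by rewrite subnSK.
have IH' := IH (ltnW jr); rewrite -e in IH'.
split.
- by apply: (@graded_sub G F (Ordinal lt)) => // V t /IH'.
- by apply: (@graded_sub F G (Ordinal lt)) => // V t /IH'.
Qed.
End FiltrationUnique.

(** * Spectral curve and partial normalization *)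

Section Tautological.
Variables (R : realType) (X : curve R) (K : line_bundle X).
Implicit Types U V W : opens X.
Local Notation C := (R[i]).

(** If the values agree, (c - c') k lies in m_p K, and the coefficient of such an element vanishes
    at [p]. *)
Lemma chart_inj U (k : K U) p c c' : frame1 k -> U p ->
  chart k (p, c) = chart k (p, c') -> c = c'.
Proof.
move=> hk Up; rewrite /chart /=; case: pselect => // h.
move=> /(congr1 (@tot_vec _ _ _)) /= e.
have : same_value p (germ (act K (fun=> c') k)) (germ (act K (fun=> c') k)).
  exact: same_value_refl.
rewrite -e => -[W [hs [ht [Wp [f [g [hf f0 /= gE]]]]]]].
have [b hb bE] := frame1_ex hs g hk.
have rc d : regular U (fun=> d : C) by exact: regular_cst.
have rcW d : regular W (fun=> d : C) by exact: regular_cst.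
move: gE; rewrite bE -actM // (res_irr ht hs) !res_act // -act_lB //.
move=> /(frame1_eq hk (rcW _) (regularM hf hb))/(_ p Wp)/eqP.
by rewrite f0 mul0r subr_eq0 => /eqP.
Qed.

Lemma tautological_chart U (k : K U) p c : frame1 k -> U p ->
  tautological k (chart k (p, c)) = c.
Proof.
move=> hk Up; rewrite /tautological.
have ex : [set d | chart k (p, c) = chart k (tot_base (chart k (p, c)), d)] c.
  by rewrite /= chart_base.
have := xgetPex 0 (ex_intro _ c ex); rewrite /= chart_base /=.
by move=> /(chart_inj hk Up) <-.
Qed.

Lemma tautological_section U (k : K U) (a : K (otop X)) c p : frame1 k ->
  coefficient k a c -> U p -> tautological k (tot_section a p) = c p.
Proof. by move=> hk hc Up; rewrite (chart_tot_section hc Up) tautological_chart. Qed.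

(** The function c u and the constant u(x) c differ by an element of m_x, so they define the same
    point of the fibre at [x]. *)
Lemma chart_change U U' W (WU : W `<=` U) (WU' : W `<=` U') (k : K U) (k' : K U') u x c :
  regular W u -> res K WU' k' = act K u (res K WU k) -> W x ->
  chart k' (x, c) = chart k (x, u x * c).
Proof.
move=> hu kE Wx; rewrite /chart /=.
case: pselect => [U'x|]; last by move=> h; exfalso; exact: h (WU' _ Wx).
case: pselect => [Ux|]; last by move=> h; exfalso; exact: h (WU _ Wx).
apply: value_eq; exists W, WU', WU; split=> //=.
have rc (Z : opens X) d : regular Z (fun=> d : C) by exact: regular_cst.
have rcu : regular W (fun y => c * u y) by exact: regularM.
exists (fun y => c * u y - u x * c), (res K WU k); split.
- exact: regularB.
- by rewrite mulrC subrr.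
- by rewrite !res_act // kE -actM // -act_lB //; exact: regularB.
Qed.

Lemma tautological_reg U (k : K U) (y : tot K) : frame1 k -> U (tot_base y) ->
  reg y (tautological k).
Proof.
move=> hk Uy /= U' k' c hk' U'y yE.
have WU : omeet U U' `<=` U by move=> x [].
have WU' : omeet U U' `<=` U' by move=> x [].
have [u hu uE] := frame1_ex WU (res K WU' k') hk.
(* As k' = u k, the coordinate with respect to [k] is u(x) T, where T is the coordinate with respect
   to [k']. *)
exists (omeet U U'), (fun x => u x *: 'X), (fun=> 1); split=> //.
- split; first by exists 2%N => x; apply: leq_trans (size_scale_leq _ _) _; rewrite size_polyX.
  move=> i x Wx; apply: (ag_germ (curve_alg_germs X) (f := fun x => u x * (i == 1%N)%:R)).
    by apply: (filterE (F := nbhs x)) => z; rewrite coefZ coefX.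
  exact: (ag_mul (curve_alg_germs X) (hu x Wx) (ag_cst (curve_alg_germs X) x _)).
- exact: poly_on1.
- by rewrite hornerC oner_eq0.
- move=> x d Wx _; rewrite /= (chart_change d hu uE Wx) tautological_chart //; last by have [] := Wx.
  by rewrite hornerZ hornerX hornerC divr1.
Qed.
End Tautological.

Section Components.
Variables (R : realType) (X : curve R) (K : line_bundle X) (n : nat).
Variables (alpha : 'I_n -> K (otop X)) (hv : in_Vnod alpha) (Q : set (spectral_curve alpha)).
Implicit Types U V W : opens X.
Local Notation P := (partial_normalization Q).
Local Notation comp := (component Q).

Definition pn_base (z : P) : X := spectral_base (pn_img z).

Lemma pn_component (z : P) : exists j, z = comp j (pn_base z).
Proof.
case: z => z b zP; have [j [p [zE bE]]] := zP; exists j; subst z b.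
by rewrite /component /pn_base /=; congr Pn; exact: Prop_irrelevance.
Qed.

Lemma range_component j (z : P) : range (comp j) z <-> comp j (pn_base z) = z.
Proof.
by split=> [[p _ <-]|e] //; exists (pn_base z).
Qed.

Lemma component_coef j l p U (k : K U) c d : frame1 k -> U p ->
  coefficient k (alpha j) c -> coefficient k (alpha l) d -> comp j p = comp l p ->
  c p = d p.
Proof.
move=> hk Up hc hd /(congr1 (fun z : P => sub_incl (pn_img z))) e.
by rewrite -(tautological_section hk hc Up) -(tautological_section hk hd Up); congr tautological.
Qed.

Lemma component_eq3 i j k p : i != j -> i != k -> j != k ->
  comp i p = comp j p -> comp i p = comp k p -> False.
Proof.
move=> ij ik jk /(congr1 (@pn_img _ _ _ _ _ _)) /= eij /(congr1 (@pn_img _ _ _ _ _ _)) /= eik.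
have [_ _ /(_ i j k ij ik jk) h] := hv.
suff : set0 (branch alpha i p) by [].
by rewrite -h; split; split; [exists p|exists p|exists p|exists p].
Qed.

Lemma pn_regular_base (A : set P) f : (forall z, A z -> reg (pn_base z) f) ->
  regular A (fun z => f (pn_base z)).
Proof. by move=> hf z Az; exact: (pn_img_reg (spectral_base_reg (hf z Az))). Qed.

Lemma pn_regular_cst (A : set P) c : regular A (fun=> c).
Proof. by apply: (@pn_regular_base A (fun=> c)) => z _; apply: ag_cst; exact: curve_alg_germs. Qed.

Lemma spectral_tautological_reg U (k : K U) : frame1 k ->
  regular (opre (spectral_pi alpha) U) (fun y => tautological k (sub_incl y)).
Proof.
move=> hk y Uy; exists (tautological k); first exact: tautological_reg.
exact: (filterE (F := nbhs y)).
Qed.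

Lemma pn_tautological_reg U (k : K U) (A : set P) : frame1 k -> (forall z, A z -> U (pn_base z)) ->
  regular A (fun z => tautological k (sub_incl (pn_img z))).
Proof.
by move=> hk AU z Az; exact: (pn_img_reg (spectral_tautological_reg hk (AU z Az))).
Qed.

Lemma pn_tautological_component U (k : K U) j c p : frame1 k -> coefficient k (alpha j) c ->
  U p -> tautological k (sub_incl (pn_img (comp j p))) = c p.
Proof. exact: tautological_section. Qed.

End Components.

(** * Restriction of sections to the irreducible components *)

Section Restriction.
Variables (R : realType) (X : curve R) (K : line_bundle X) (n : nat).
Variables (alpha : 'I_n -> K (otop X)) (Q : set (spectral_curve alpha)).
Local Notation P := (partial_normalization Q).
Local Notation comp := (component Q).
Variables (L : sheaf P) (N : 'I_n -> sheaf X).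
Variable pb : forall j, pullback (component_incl Q j) L (N j).
Implicit Types (U V W : opens X) (A B : opens P).

(** [V] may be any open set mapped into [A], so that restrictions of sections over different opens
    can be compared over one set. *)
Definition restr j A V (h : forall x, V x -> A (comp j x)) (s : L A) : N j V :=
  res (N j) (U := opre (component_incl Q j) A) h (pb j A s).

Lemma restr_res j A B V (BA : B `<=` A) (hB : forall x, V x -> B (comp j x))
    (hA : forall x, V x -> A (comp j x)) (s : L A) :
  restr hB (res L BA s) = restr hA s.
Proof. by rewrite /restr hom_res /=; exact: res_comp. Qed.

Lemma restr_resV j A V W (WV : W `<=` V) (hV : forall x, V x -> A (comp j x))
    (hW : forall x, W x -> A (comp j x)) (s : L A) :
  res (N j) WV (restr hV s) = restr hW s.
Proof. by rewrite /restr; exact: res_comp. Qed.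

Lemma restr_act j A V (h : forall x, V x -> A (comp j x)) f (s : L A) : regular A f ->
  restr h (act L f s) = act (N j) (fun x => f (comp j x)) (restr h s).
Proof.
move=> hf; rewrite /restr hom_act //= res_act // => x Ax.
by apply: component_reg; exact: hf.
Qed.

Lemma regular_component j A V f : (forall x, V x -> A (comp j x)) -> regular A f ->
  regular V (fun x => f (comp j x)).
Proof. by move=> h hf x Vx; apply: component_reg; apply: hf; exact: h. Qed.

Lemma restrD j A V (h : forall x, V x -> A (comp j x)) (s t : L A) :
  restr h (s + t) = restr h s + restr h t.
Proof. by rewrite /restr homD resD. Qed.

Lemma restr0 j A V (h : forall x, V x -> A (comp j x)) : restr h (0 : L A) = 0.
Proof. by rewrite /restr hom0 res_0. Qed.

Lemma restrB j A V (h : forall x, V x -> A (comp j x)) (s t : L A) :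
  restr h (s - t) = restr h s - restr h t.
Proof. by rewrite /restr homB res_B. Qed.

Lemma restr_frame1 j A V (h : forall x, V x -> A (comp j x)) (e : L A) :
  frame1 e -> frame1 (restr h e).
Proof. by move=> he; apply: frame1S; exact: (pb_frame (pb j) he). Qed.

(** The coefficient is an honest function, so it may be tested at points; each point lies on some
    component, where the restricted frame is still a frame. *)
Lemma restr_eq0 A B (BA : B `<=` A) (e : L A) f : frame1 e -> regular B f ->
  (forall j V (h : forall x, V x -> B (comp j x)), restr h (act L f (res L BA e)) = 0) ->
  act L f (res L BA e) = 0.
Proof.
move=> he hf h0; apply: act_0; first exact: pn_regular_cst.
move=> z Bz; have [j zE] := pn_component z.
pose V := opre (component_incl Q j) B.
have hV : forall x, V x -> B (comp j x) by [].
have := h0 j V hV; rewrite restr_act //.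
have hVA x : V x -> A (comp j x) by move=> /hV/BA.
rewrite (restr_res _ _ hVA) -[restr hVA e]res_id.
have hfV := regular_component hV hf.
move=> /(frame1_eq0 (restr_frame1 hVA he) (@regular_cst _ _ _ _) hfV)/(_ (pn_base z)).
by rewrite -zE; apply; rewrite /V /= -zE.
Qed.

Lemma restr_inj A (s : L A) : locally_free L 1 ->
  (forall j V (h : forall x, V x -> A (comp j x)), restr h s = 0) -> s = 0.
Proof.
move=> hL h0; apply: sec_sep => z Az; have [B [Bz [e /frame_frame1 he]]] := hL z.
have hl : omeet A B `<=` A by move=> y [].
have hr : omeet A B `<=` B by move=> y [].
exists (omeet A B), hl; split=> //; rewrite res_0.
have [f hf sE] := frame1_ex hr (res L hl s) he.
rewrite sE; apply: restr_eq0 => // j V h; rewrite -sE.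
have hA x : V x -> A (comp j x) by move=> /h[].
by rewrite (restr_res _ _ hA).
Qed.
End Restriction.

(** * The filtration by support *)

Section SpectralFlag.
Variables (R : realType) (X : curve R) (K : line_bundle X) (n : nat).
Variables (alpha : 'I_n -> K (otop X)) (hv : in_Vnod alpha) (Q : set (spectral_curve alpha)).
Local Notation P := (partial_normalization Q).
Local Notation comp := (component Q).
Local Notation C := (R[i]).
Variables (L : sheaf P) (hL : locally_free L 1) (N : 'I_n -> sheaf X).
Variable pb : forall j, pullback (component_incl Q j) L (N j).
Variables (r : nat) (J : r.-tuple 'I_n) (uJ : uniq J) (O : opens P).
Hypothesis hJ : forall j p, O (comp j p) <-> j \in J.
Variable below : rel 'I_r.
Hypothesis below_le : forall i j, below i j -> (i <= j)%N.
Hypothesis below_meet : forall (i j : 'I_r) p, (i <= j)%N ->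
  comp (tnth J i) p = comp (tnth J j) p -> below i j.
Variable E : higgs K.
Variable theta : hom E (pushforward (spectral_pi alpha) (pushforward (pn_nu Q) (restrict_open L O))).
Hypothesis theta_iso : hom_iso theta.
Hypothesis theta_phi : forall (U : opens X) (k : K U) (s : E U), frame1 k ->
  theta U (phi k s) = act (pushforward (pn_nu Q) (restrict_open L O)) (U := opre (spectral_pi alpha) U)
    (fun y => tautological k (sub_incl y)) (theta U s).
Implicit Types (U V W : opens X) (A B : opens P).

Definition over U : opens P := omeet (opre (pn_nu Q) (opre (spectral_pi alpha) U)) O.

Definition spectral_sec U (s : E U) : L (over U) := theta U s.

Lemma over_component (i : 'I_r) U x : U x -> over U (comp (tnth J i) x).
Proof. by move=> Ux; split=> //; apply/hJ; exact: mem_tnth. Qed.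

Lemma overS U V : V `<=` U -> over V `<=` over U.
Proof. by move=> VU z [Vz Oz]; split=> //; exact: VU. Qed.

Lemma spectral_sec_res U V (VU : V `<=` U) (h : over V `<=` over U) (s : E U) :
  spectral_sec (res E VU s) = res L h (spectral_sec s).
Proof. by rewrite /spectral_sec hom_res /=; exact: res_irr. Qed.

Let rho_fun (i : 'I_r) U (s : E U) : N (tnth J i) U :=
  restr pb (@over_component i U) (spectral_sec s).

Definition rho (i : 'I_r) : hom E (N (tnth J i)).
Proof.
refine (@Hom R X E (N (tnth J i)) (rho_fun i) _ _ _).
- by move=> U s t; rewrite /rho_fun /spectral_sec homD restrD.
- move=> U f s hf; rewrite /rho_fun /spectral_sec hom_act //=.
  rewrite restr_act; first exact: act_ext.
  by apply: (@pn_regular_base _ _ _ _ _ _ (over U) f) => z [Uz _]; exact: hf.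
- move=> U V VU s; rewrite /rho_fun (spectral_sec_res VU (overS VU)).
  rewrite (restr_resV pb VU _ (fun x Vx => over_component i (VU x Vx))).
  exact: restr_res.
Defined.

Lemma rho_inj U (s : E U) : (forall i, rho i U s = 0) -> s = 0.
Proof.
move=> h0; have [g gK _] := theta_iso U; rewrite -(gK s) -(gK 0); congr g.
rewrite hom0; apply: (restr_inj (pb := pb) (A := over U)) => // j V h.
(* [hJ] relates a component to [O] only through its points, so an empty [V] is treated apart. *)
have [[x Vx]|V0] := pselect (exists x, V x); last by apply: sec_empty => x Vx; apply: V0; exists x.
have /tnthP[i ji] : j \in J by apply/(hJ j x); have [] := h x Vx.
subst j; have VU : V `<=` U by move=> y /h[].
have := h0 i => /(congr1 (res _ VU)); rewrite res_0 /= /rho_fun.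
by rewrite (restr_resV pb VU _ h).
Qed.

Lemma rho_phi i U (k : K U) c (s : E U) : frame1 k -> coefficient k (alpha (tnth J i)) c ->
  rho i U (phi k s) = act (N (tnth J i)) c (rho i U s).
Proof.
move=> hk hc; rewrite /= /rho_fun /spectral_sec theta_phi //=.
rewrite restr_act; last by apply: (pn_tautological_reg (U := U)) => // z [].
by apply: act_ext => x Ux; exact: tautological_section hc Ux.
Qed.

(** * Adapted sections near one point of the partial normalization *)

Section Local.
Variables (p : X) (i : 'I_r).
Local Notation j := (tnth J i).
Local Notation y := (comp j p).
Variables (U : opens X) (k : K U) (c : 'I_n -> X -> C).
Hypotheses (hk : frame1 k) (hc : forall l, coefficient k (alpha l) (c l)).
Variables (B : opens P) (e : L B) (he : frame1 e).
Variables (V : opens X) (Vp : V p) (VU : V `<=` U).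
Hypothesis c_diff : forall l l' x, V x -> l != l' -> x != p -> c l x != c l' x.
Hypothesis VB : forall l x, comp l p = y -> V x -> B (comp l x).

Lemma meet_eq l l' x : V x -> l != l' -> comp l x = comp l' x -> x = p.
Proof.
move=> Vx ll' lE; apply/eqP/negPn/negP => xp.
move/eqP: (c_diff Vx ll' xp); apply.
exact: component_coef hk (VU Vx) (hc l) (hc l') lE.
Qed.

(** Openness is tested on each component. Over [V] distinct components meet at most above [p], so a
    component lies in the set entirely or not at all, according to whether it passes through
    [comp j p]. *)
Lemma sheet_open : open [set z : P | V (pn_base z) /\
  exists2 l, comp l p = y & z = comp l (pn_base z)].
Proof.
move=> m; rewrite [X in open X](_ : _ = [set x | V x /\ comp m p = y]).
  have [my|my] := pselect (comp m p = y).
    rewrite (_ : [set x | _] = V); first exact: ocarP.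
    by apply/seteqP; split=> x //= [].
  rewrite (_ : [set x | _] = set0); first exact: open0.
  by apply/seteqP; split=> x //= [].
apply/seteqP; split=> x /= [Vx]; last by move=> my; split=> //; exists m.
move=> [l ly lE]; split=> //; have [->//|ml] := eqVneq m l.
have xp : x = p := meet_eq Vx ml lE; subst x.
by rewrite lE.
Qed.

Lemma off_sheet_open : open [set z : P | over V z /\
  ~ exists2 l, comp l p = y & z = comp l (pn_base z)].
Proof.
move=> m; have [my|my] := pselect (comp m p = y).
  rewrite [X in open X](_ : _ = set0); first exact: open0.
  by apply/seteqP; split=> x //= [_]; apply; exists m.
rewrite [X in open X](_ : _ = component_incl Q m @^-1` (over V)).
  exact: (ocarP (opre (component_incl Q m) (over V))).
apply/seteqP; split=> x /=; first by case.
move=> [Vx Ox]; split=> // -[l ly lE].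
have [ml|ml] := eqVneq m l; first by rewrite ml in my.
have xp : x = p := meet_eq Vx ml lE; subst x.
by apply: my; rewrite lE.
Qed.

Definition sheet : opens P := Opens sheet_open.
Definition off_sheet : opens P := Opens off_sheet_open.

Lemma sheet_over : sheet `<=` over V.
Proof.
move=> z [Vz [l ly lE]]; split=> //; rewrite lE; apply/hJ/(hJ l p).
by rewrite ly; apply/hJ; exact: mem_tnth.
Qed.

Lemma off_sheet_over : off_sheet `<=` over V.
Proof. by move=> z []. Qed.

Lemma sheet_base : sheet `<=` opre (pn_nu Q) (opre (spectral_pi alpha) V).
Proof. by move=> z []. Qed.

Lemma sheet_B : sheet `<=` B.
Proof. by move=> z [Vz [l ly ->]]; exact: VB. Qed.

Lemma sheet_component l x : comp l p = y -> V x -> sheet (comp l x).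
Proof. by move=> ly Vx; split=> //; exists l. Qed.

Lemma off_sheet_component (l : 'I_r) x : comp (tnth J l) p <> y -> V x -> off_sheet (comp (tnth J l) x).
Proof.
move=> ly Vx; split; first exact: over_component.
move=> [m my lE]; have [lm|lm] := eqVneq (tnth J l) m; first by rewrite lm in ly.
have xp : x = p := meet_eq Vx lm lE; subst x.
by apply: ly; rewrite lE.
Qed.

(** The part of [O] over [V] is the disjoint union of [sheet] and [off_sheet]: extend by zero and
    transport through the inverse of [theta]. *)
Lemma sheet_extend (s : L sheet) : exists t : E V,
  (forall (l : 'I_r) (ly : comp (tnth J l) p = y),
     rho l V t = restr pb (fun x => sheet_component ly) s) /\
  (forall l : 'I_r, comp (tnth J l) p <> y -> rho l V t = 0).
Proof.
have [||t [ts t0]] := extend_zero sheet_over off_sheet_over s.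
- move=> z [Vz Oz]; have [h|h] := pselect (exists2 l, comp l p = y & z = comp l (pn_base z)).
    by left.
  by right; split.
- by move=> z [Vz h] [_].
have [g _ gK] := theta_iso V; exists (g t); split.
- by move=> l ly; rewrite /= /rho_fun /spectral_sec gK -ts; exact/esym/restr_res.
- move=> l ly; rewrite /= /rho_fun /spectral_sec gK.
  have hoff x : V x -> off_sheet (comp (tnth J l) x) by exact: off_sheet_component.
  by have := restr_res pb off_sheet_over hoff (@over_component l V) t; rewrite t0 restr0 => <-.
Qed.
Let eT : L sheet := res L sheet_B e.
Let on_sheet (l : 'I_r) (ly : comp (tnth J l) p = y) x (Vx : V x) : sheet (comp (tnth J l) x) :=
  sheet_component ly Vx.
Let eta : N j V := restr pb (on_sheet (erefl y)) eT.

Lemma eta_frame1 : frame1 eta.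
Proof. by apply: restr_frame1; exact: frame1S. Qed.

(* If J l, l > i, passes through comp j p, then lambda - alpha_(J l) kills the component J l
   and restricts to the local equation alpha_j - alpha_(J l) of the node on J i. *)
Lemma local_equation : exists (s : L sheet) (delta : X -> C),
  [/\ regular V delta, restr pb (on_sheet (erefl y)) s = act (N j) delta eta,
      forall (l : 'I_r) (ly : comp (tnth J l) p = y), ~~ below l i -> restr pb (on_sheet ly) s = 0,
      forall x, V x -> x != p -> delta x != 0
    & delta p != 0 /\ later_nodes Q J i p = 0%N \/
      [/\ uniformizer p delta, later_nodes Q J i p = 1%N &
        exists2 l : 'I_r, (i < l)%N & comp (tnth J l) p = y]].
Proof.
have [[l0 il0 l0y]|none] := pselect (exists2 l : 'I_r, (i < l)%N & comp (tnth J l) p = y).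
  have hcr l : regular U (c l) by have [] := hc l.
  have hcV l : regular V (c l) by exact: regularS VU (hcr l).
  pose tau (z : P) := tautological k (sub_incl (pn_img z)).
  pose cb (z : P) := c (tnth J l0) (pn_base z).
  have htau : regular sheet tau.
    by apply: (pn_tautological_reg (U := U)) => // z /sheet_base /VU.
  have hcb : regular sheet cb.
    apply: pn_regular_base => z /sheet_base /VU; exact: hcr.
  have ne (l l' : 'I_r) : l != l' -> tnth J l != tnth J l'.
    by move=> ll'; rewrite (inj_eq (tuple_uniqP _ uJ)).
  have sE (l : 'I_r) (ly : comp (tnth J l) p = y) :
      restr pb (on_sheet ly) (act L tau eT - act L cb eT) =
      act (N (tnth J l)) (fun x => c (tnth J l) x - c (tnth J l0) x) (restr pb (on_sheet ly) eT).
    rewrite restrB !restr_act //.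
    rewrite act_lB //; [|exact: regular_cst|exact: regularB].
    congr (_ - _); apply: act_ext => x Vx //.
    by rewrite /tau (pn_tautological_component Q hk (hc _) (VU Vx)).
  have il : i != l0 by apply/eqP => e0; move: il0; rewrite e0 ltnn.
  exists (act L tau eT - act L cb eT), (fun x => c j x - c (tnth J l0) x); split.
  - by apply: regularB; exact: hcV.
  - exact: sE.
  - move=> l ly; have [e0|ll0] := eqVneq l0 l.
      subst l; rewrite sE => _; apply: act_0; first exact: regular_cst.
      by move=> x _; rewrite subrr.
    have [e0|li] := eqVneq l i; first by subst l; rewrite (@below_meet i i p).
    (* The components of indices [i], [l0] and [l] would be three distinct ones through one
       point. *)
    case: (@component_eq3 _ _ _ _ _ hv Q j (tnth J l0) (tnth J l) p) => //.
    + exact: ne.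
    + by apply: ne; rewrite eq_sym.
    + exact: ne.
  - by move=> x Vx xp; rewrite subr_eq0; apply: c_diff => //; exact: ne.
  - right; split; last by exists l0.
    + have [_ hu _] := hv; apply: (hu _ _ (ne _ _ il) U k) => //.
      * exact: coefficientB.
      * exact: VU.
      * apply/eqP; rewrite subr_eq0; apply/eqP.
        by apply: (component_coef hk (VU Vp) (hc _) (hc _)); exact: esym l0y.
    + rewrite /later_nodes (bigD1 l0) //= asboolT; last by apply/range_component.
      rewrite big1 // => l /andP[il' ll0]; rewrite asboolF // => /range_component ly.
      case: (@component_eq3 _ _ _ _ _ hv Q j (tnth J l0) (tnth J l) p) => //.
      * exact: ne.
      * by apply: ne; apply/eqP => e0; move: il'; rewrite e0 ltnn.
      * by apply: ne; rewrite eq_sym.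
(* No later component passes through the point, so the frame itself will do: all components through
   it have index at most [i], hence are below [i] by [below_meet]. *)
exists eT, (fun=> 1); split.
- exact: regular_cst.
- by rewrite act1.
- move=> l ly; have [il|li] := ltnP i l; first by case: none; exists l.
  by rewrite (below_meet li ly).
- by move=> *; exact: oner_neq0.
- left; split; first exact: oner_neq0.
  rewrite /later_nodes big1 // => l il; rewrite asboolF // => /range_component ly.
  by apply: none; exists l.
Qed.
Lemma later_nodes0 x : V x -> x != p -> later_nodes Q J i x = 0%N.
Proof.
move=> Vx xp; rewrite /later_nodes big1 // => l il; rewrite asboolF // => /range_component ly.
move/eqP: xp; apply; apply: meet_eq Vx _ ly.
rewrite (inj_eq (tuple_uniqP _ uJ)); apply/eqP => e0.
by move: il; rewrite e0 ltnn.
Qed.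

(** One function [f] on the partial normalization serves all components through the point. Its value
    at the node is common to them, which is how vanishing on one component forces vanishing at the
    node on another. *)
Lemma rho_near W (WV : W `<=` V) (s : E W) : exists f : P -> C,
  regular (omeet sheet (over W)) f /\
  forall (l : 'I_r) (ly : comp (tnth J l) p = y),
    rho l W s = act (N (tnth J l)) (fun x => f (comp (tnth J l) x))
      (res (N (tnth J l)) WV (restr pb (on_sheet ly) eT)).
Proof.
have hs : omeet sheet (over W) `<=` sheet by move=> z [].
have hW : omeet sheet (over W) `<=` over W by move=> z [].
have hB : omeet sheet (over W) `<=` B by move=> z /hs/sheet_B.
have [f hf fE] := frame1_ex hB (res L hW (spectral_sec s)) he.
exists f; split=> // l ly.
have hl x : W x -> omeet sheet (over W) (comp (tnth J l) x).
  by move=> Wx; split; [apply: on_sheet => //; exact: WV|exact: over_component].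
have hWs x : W x -> sheet (comp (tnth J l) x) by move=> /hl[].
rewrite /= /rho_fun -(restr_res pb hW hl) fE restr_act //; congr (act _ _ _).
rewrite (restr_resV pb WV _ hWs) /eT restr_res.
  by move=> x /hWs /sheet_B.
by move=> ?; rewrite restr_res.
Qed.

Lemma flag_section_near : exists s : E V, flag_section rho (later_nodes Q J) below i s.
Proof.
have [sg [delta [hd sgE sg0 dn dp]]] := local_equation.
have [s [sE s0]] := sheet_extend sg.
have r0 W : regular W (fun=> 0 : C) by exact: regular_cst.
have sdE : rho i V s = act (N j) delta eta by rewrite (sE i (erefl _)); exact: sgE.
have sdW W (WV : W `<=` V) : rho i W (res E WV s) = act (N j) delta (res (N j) WV eta).
  by rewrite hom_res sdE res_act.
(* Divisibility by [delta] asks only for vanishing at [p] when a later node is counted there; both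
   generation clauses reduce to this. *)
have divides W (WV : W `<=` V) f : regular W f ->
    (W p -> (0 < later_nodes Q J i p)%N -> f p = 0) ->
    exists2 u, regular W u &
      act (N j) f (res (N j) WV eta) = act (N j) u (rho i W (res E WV s)).
  move=> hf fp; have hdW := regularS WV hd.
  have [u hu uE] : exists2 u, regular W u & forall x, W x -> f x = delta x * u x.
    apply: (divide_uniformizer (p := p)) => //; first by move=> x /WV; exact: dn.
    move=> Wp dp0; case: dp => [[]|[ud D1 _]]; first by rewrite dp0 eqxx.
    by split=> //; apply: fp; rewrite ?D1.
  exists u => //; rewrite sdW -actM //; apply: act_ext => x Wx.
  by rewrite uE // mulrC.
exists s; split.
- move=> l bl; have [ly|ly] := pselect (comp (tnth J l) p = y); last exact: s0.
  by rewrite sE; exact: sg0.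
- move=> W WV t ht; have [f [hf fE]] := rho_near WV t.
  rewrite (fE i (erefl _)); apply: (divides W WV).
    apply: (regular_component _ hf) => x Wx.
    by split; [exact: (on_sheet _ (WV _ Wx))|exact: over_component].
  (* [f] vanishes along the later component [l], hence at the point that it shares with the
     component of index [i]. *)
  move=> Wp Dp; case: dp => [[_ D0]|[_ _ [l il ly]]]; first by rewrite D0 in Dp.
  have := ht l il; rewrite (fE l ly).
  have hfl : regular W (fun x => f (comp (tnth J l) x)).
    apply: (regular_component _ hf) => x Wx.
    by split; [exact: (on_sheet _ (WV _ Wx))|exact: over_component].
  have fr : frame1 (restr pb (on_sheet ly) eT) by apply: restr_frame1; exact: frame1S.
  by move=> /(frame1_eq0 fr (r0 _) hfl)/(_ p Wp); rewrite ly.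
- move=> W WV t ht; have [f hf tE] := frame1_ex WV t eta_frame1.
  rewrite tE; apply: (divides W WV) => // Wp Dp.
  by rewrite tE in ht; exact: twist_vanish eta_frame1 hf ht Wp Dp.
(* [delta] has the order that [later_nodes] prescribes: 1 at a later node, where it is itself the
   uniformizer; where the multiplicity is 0, any uniformizer may be quoted. *)
- rewrite sdE; apply: twist_act => x Vx.
  have [xp|xp] := eqVneq x p; last first.
    have [t ht] := curve_smooth x; exists t, delta; split=> //; first exact: hd.
    by apply: (filterE (F := nbhs x)) => z; rewrite later_nodes0 // mul1r.
  rewrite xp; case: dp => [[_ D0]|[ud D1 _]].
    have [t ht] := curve_smooth p; exists t, delta; split=> //; first exact: hd.
    by apply: (filterE (F := nbhs p)) => z; rewrite D0 mul1r.
  exists delta, (fun=> 1); split=> //; first by apply: ag_cst; exact: curve_alg_germs.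
  by apply: (filterE (F := nbhs p)) => z; rewrite D1 mulr1.
- move=> W WV u hu; rewrite sdW -actM //; last exact: regularS hd.
  rewrite (act_ext (g := fun x => delta x * u x)); last by move=> x _; rewrite mulrC.
  have hdW := regularS WV hd.
  rewrite actM // => /(torsion_free WV eta_frame1 hdW) h.
  have {}h : act (N j) u (res (N j) WV eta) = 0 by apply: (h p) => x /WV; exact: dn.
  exact: (frame1_eq0 eta_frame1 (r0 _) hu h).
Qed.
End Local.

(** Finitely many shrinkings suffice: distinct alpha's differ off [p], and every component through
    the chosen point stays in the domain of the frame of [L]. *)
Lemma spectral_flag_local (p : X) : exists V, V p /\
  exists e : 'I_r -> E V, forall i, flag_section rho (later_nodes Q J) below i (e i).
Proof.
apply: flag_section_all => i.
have [U Up [k hk]] := frame1_cover K p.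
have hc l : {c | coefficient k (alpha l) c} by apply: cid; exact: coefficient_ex.
pose c l := sval (hc l).
have [B [By [e /frame_frame1 he]]] := hL (comp (tnth J i) p).
have cn (ll' : 'I_n * 'I_n) :
    \forall x \near p, ll'.1 != ll'.2 -> x != p -> c ll'.1 x != c ll'.2 x.
  have [->|ll] := eqVneq ll'.1 ll'.2; first exact: (filterE (F := nbhs p)).
  apply: filterS (coefficient_diff_near hv ll hk (svalP (hc _)) (svalP (hc _)) Up).
  by move=> x h _ /h; rewrite subr_eq0.
have Bn l : \forall x \near p, comp l p = comp (tnth J i) p -> B (comp l x).
  have [ly|ly] := pselect (comp l p = comp (tnth J i) p); last exact: (filterE (F := nbhs p)).
  have h : opre (component_incl Q l) B p by rewrite /opre /omem /= ly.
  by apply: filterS (near_open h).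
have [V0 V0p hV0] := near_opens (filterI (near_forall cn) (near_forall Bn)).
have VU : omeet U V0 `<=` U by move=> x [].
have [||s hs] := @flag_section_near p i U k c hk (fun l => svalP (hc l)) B (e ord0) he
  (omeet U V0) (conj Up V0p) VU.
- by move=> l l' x [_ /hV0[h _]]; exact: (h (l, l')).
- by move=> l x ly [_ /hV0[_ h]]; exact: h.
by exists (omeet U V0); split; [split|exists s].
Qed.

End SpectralFlag.

(** * Reduction of the structure group *)

Section Transition.
Variables (R : realType) (X : curve R) (E : sheaf X) (r : nat).
Implicit Types U V W : opens X.

Lemma lincombS U V W (VU : V `<=` U) (WV : W `<=` V) (WU : W `<=` U) f (e : 'I_r -> E U) :
  (forall i, regular V (f i)) -> res E WV (lincomb VU f e) = lincomb WU f e.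
Proof.
move=> hf; rewrite /lincomb res_sum; apply: eq_bigr => i _.
by rewrite res_act // (res_comp _ _ WU).
Qed.

(** The entries of the product and the Kronecker deltas are both coefficients of [e j] in the frame
    [e]. *)
Lemma transition_mul U V W (WU : W `<=` U) (WV : W `<=` V) (e : 'I_r -> E U)
    (e' : 'I_r -> E V) (A B : 'I_r -> 'I_r -> X -> R[i]) :
  frame e -> (forall i j, regular W (A i j)) -> (forall i j, regular W (B i j)) ->
  (forall j, res E WV (e' j) = lincomb WU (fun i => A i j) e) ->
  (forall j, res E WU (e j) = lincomb WV (fun i => B i j) e') ->
  forall z, W z -> (\matrix_(i, j) A i j z) *m (\matrix_(i, j) B i j z) = 1%:M.
Proof.
move=> he hA hB eA eB z Wz; apply/matrixP => l j; rewrite !mxE.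
under eq_bigr => i _ do rewrite !mxE.
have hAB m : regular W (fun x => \sum_i A m i x * B i j x).
  by apply: (@regular_sum _ _ _ _ (fun i x => A m i x * B i j x)) => i; exact: regularM.
have [f [hf _ fU]] := he W WU (res E WU (e j)).
transitivity (f l z).
  apply: (fU (fun m x => \sum_i A m i x * B i j x)) => //.
  rewrite eB /lincomb; under eq_bigr => i _ do rewrite eA /lincomb act_sumr //.
  rewrite exchange_big /=; apply: eq_bigr => m _.
  have hBA i : regular W (fun x => A m i x * B i j x) by exact: regularM.
  rewrite -(act_suml _ hBA); apply: eq_bigr => i _.
  rewrite -actM //; apply: act_ext => x _; exact: mulrC.
apply/esym; apply: (fU (fun m _ => (m == j)%:R)) => //; first by move=> m; exact: regular_cst.
rewrite /lincomb (bigD1 j) //= eqxx act1 big1 ?addr0 // => m /negPf->.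
by apply: act_0 => //; exact: regular_cst.
Qed.
End Transition.

Section FlagReduction.
Variables (R : realType) (X : curve R) (K : line_bundle X) (n : nat) (E : higgs K).
Variables (N : 'I_n -> sheaf X) (rho : forall i, hom E (N i)).
Variables (a : 'I_n -> K (otop X)) (D : 'I_n -> X -> nat) (sh : seq nat).
Implicit Types U V W : opens X.

Definition block_le : rel 'I_n :=
  fun i j => (reshape_index sh i == reshape_index sh j) && (i <= j)%N.

Lemma block_le_trans i j l : block_le i j -> block_le l i -> block_le l j.
Proof.
by move=> /andP[/eqP ij le_ij] /andP[/eqP li le_li]; rewrite /block_le li ij eqxx (leq_trans le_li).
Qed.

Hypothesis rho_inj : forall U (s : E U), (forall i, rho i U s = 0) -> s = 0.
Hypothesis rho_phi : forall i U (k : K U) c (s : E U), frame1 k -> coefficient k (a i) c ->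
  rho i U (phi k s) = act (N i) c (rho i U s).
Hypothesis flag_local : forall p : X, exists V, V p /\
  exists e : 'I_n -> E V, forall i, flag_section rho D block_le i (e i).

Lemma flag_reduction : reduction n E (borel_prod sh) (borel_lie sh).
Proof.
pose U x := projT1 (cid (flag_local x)).
have Ux x : U x x by exact: (projT2 (cid (flag_local x))).1.
pose e x : 'I_n -> E (U x) := projT1 (cid (projT2 (cid (flag_local x))).2).
have he x i : flag_section rho D block_le i (e x i).
  exact: (projT2 (cid (projT2 (cid (flag_local x))).2)).
have bl i j : block_le i j -> (i <= j)%N by move=> /andP[].
have fe x : frame (e x) by exact: flag_frame (he x).
(* The set of indices related to [j] by [block_le] is a lower set by transitivity, so [flag_coef0]
   applies to each column. *)
have triangular x W (WU : W `<=` U x) j f (s : E W) : (forall i, regular W (f i)) ->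
    s = lincomb WU f (e x) -> (forall l, ~~ block_le l j -> rho l W s = 0) ->
    forall i, ~~ block_le i j -> forall z, W z -> f i z = 0.
  move=> hf sE s0; apply: (flag_coef0 (B := fun i => block_le i j) bl (he x) _ hf sE s0).
  by move=> i' l hi hl; exact: block_le_trans hi hl.
exists U, e; split=> //.
- move=> x y; set W := omeet (U x) (U y).
  have Wx : W `<=` U x by move=> z [].
  have Wy : W `<=` U y by move=> z [].
  have coef x' y' (Wx' : W `<=` U x') (Wy' : W `<=` U y') :
      {A : 'I_n -> 'I_n -> X -> R[i] | (forall i j, regular W (A i j)) /\
        forall j, res E Wy' (e y' j) = lincomb Wx' (fun i => A i j) (e x')}.
    have h j : {f | (forall i, regular W (f i)) /\ res E Wy' (e y' j) = lincomb Wx' f (e x')}.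
      by apply: cid; have [f [hf fE _]] := fe x' W Wx' (res E Wy' (e y' j)); exists f.
    exists (fun i j => sval (h j) i); split.
      by move=> i j; have [] := svalP (h j).
    by move=> j; have [] := svalP (h j).
  have [A [hA AE]] := coef x y Wx Wy; have [B [hB BE]] := coef y x Wy Wx.
  exists (fun z => \matrix_(i, j) A i j z); split.
    move=> z zx zy; have Wz : W z by [].
    split; last by have /mulmx1_unit[] := transition_mul (fe x) hA hB AE BE Wz.
    move=> i j ij; rewrite mxE; apply: (triangular x W Wx j _ _ (hA^~ j) (AE j)) => // l lj.
    by have [e0 _ _ _ _] := he y j; rewrite hom_res e0 // res_0.
  move=> Z Zx Zy; have ZW : Z `<=` W by move=> z Zz; split; [exact: Zx|exact: Zy].
  split=> [i j|j].
    rewrite (_ : (fun z => _) = A i j); first exact: regularS (hA i j).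
    by apply/funext => z; rewrite mxE.
  rewrite -(res_comp Wy ZW) AE (lincombS _ _ Zx) //.
  by rewrite /lincomb; apply: eq_bigr => i _; congr (act E _ _); apply/funext => z; rewrite mxE.
- move=> x W Wx k hk.
  have h j : {f | (forall i, regular W (f i)) /\ phi k (res E Wx (e x j)) = lincomb Wx f (e x)}.
    by apply: cid; have [f [hf fE _]] := fe x W Wx (phi k (res E Wx (e x j))); exists f.
  pose M (z : X) : 'M[R[i]]_n := \matrix_(i, j) sval (h j) i z.
  have ME i j : (fun z => M z i j) = sval (h j) i by apply/funext => z; rewrite mxE.
  exists M; split.
  + move=> z Wz i j ij; have [hf fE] := svalP (h j).
    rewrite mxE; apply: (triangular x W Wx j _ _ hf fE) => // l lj.
    (* Through [rho l] the Higgs field is multiplication by a function, so it keeps sections killed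
       by [rho l] killed. *)
    have [c hc] := coefficient_ex (a l) hk; have [e0 _ _ _ _] := he x j.
    by rewrite (rho_phi _ hk hc) hom_res e0 // res_0 act_r0 //; case: hc.
  + by move=> i j; rewrite ME; have [hf _] := svalP (h j).
  + move=> j; have [_ ->] := svalP (h j).
    by rewrite /lincomb; apply: eq_bigr => i _; rewrite ME.
Qed.
End FlagReduction.

(** * Ordering the components by connected components *)

Section ConnectedComponents.
Variables (R : realType) (X : curve R) (K : line_bundle X) (n : nat).
Variables (alpha : 'I_n -> K (otop X)) (Q : set (spectral_curve alpha)).
Variables (m : nat) (Y : 'I_m -> opens (partial_normalization Q)).
Hypothesis hY : enum_components Y.

(** One point decides: a component meeting two members of [Y] would contain two nonempty opens
    without a common point, against [open_meet]. *)
Lemma component_indicesE i j p : Y i (component Q j p) <-> j \in component_indices Y i.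
Proof.
rewrite inE; split=> [Yp|/asboolP]; last by apply.
apply/asboolP => q; have [i' [Yq _]] := hY.2 (component Q j q).
have [x [Yx Yx']] := open_meet (ocarP (opre (component_incl Q j) (Y i)))
  (ocarP (opre (component_incl Q j) (Y i'))) (ex_intro _ p Yp) (ex_intro _ q Yq).
have [i0 [_ h]] := hY.2 (component Q j x).
by rewrite -(h i Yx) (h i' Yx').
Qed.

Lemma component_indices_ex j : exists i, j \in component_indices Y i.
Proof.
have [p _] := curve_point X.
have [i [Yi _]] := hY.2 (component Q j p).
by exists i; apply/component_indicesE; exact: Yi.
Qed.

Lemma component_indices_inj i i' j p j' : j \in component_indices Y i ->
  j' \in component_indices Y i' -> component Q j p = component Q j' p -> i = i'.
Proof.
move=> /(component_indicesE _ _ p) h /(component_indicesE _ _ p) h' e.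
have [i0 [_ u]] := hY.2 (component Q j p).
by rewrite -(u i h); apply: u; rewrite e.
Qed.

Let ss := [seq enum (component_indices Y i) | i <- enum 'I_m].

Lemma components_perm : perm_eq (flatten ss) (enum 'I_n).
Proof.
have [p _] := curve_point X.
apply/allP => j _ /=; rewrite (count_uniq_mem _ (enum_uniq _)) mem_enum inE.
have [i ij] := component_indices_ex j.
rewrite count_flatten sumnE 2!big_map big_enum /= (bigD1 i) //= big1.
  by rewrite (count_uniq_mem _ (enum_uniq _)) mem_enum ij.
move=> i' i'i; apply/eqP; rewrite (count_uniq_mem _ (enum_uniq _)) mem_enum eqb0.
by apply: contra i'i => ij'; apply/eqP; exact: (component_indices_inj (p := p) ij' ij).
Qed.

(** Indices are listed one connected component after another, so that the blocks of sizes |C_i| are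
    the connected components. *)
Definition component_order : n.-tuple 'I_n.
Proof.
exists (flatten ss); apply/eqP.
by rewrite (perm_size components_perm) size_enum_ord.
Defined.

Lemma component_orderP (k : 'I_n) : exists i : 'I_m,
  reshape_index [seq #|component_indices Y i| | i <- enum 'I_m] k = i /\
  tnth component_order k \in component_indices Y i.
Proof.
have shE : [seq #|component_indices Y i| | i <- enum 'I_m] = shape ss.
  by rewrite /shape -[in RHS]map_comp; apply: eq_map => i; rewrite /= cardE.
have ks : (k < sumn (shape ss))%N.
  by rewrite -size_flatten (perm_size components_perm) size_enum_ord.
have rm := reshape_indexP ks; have := reshape_offsetP ks.
rewrite shE; rewrite size_map size_map size_enum_ord in rm.
exists (Ordinal rm); split=> //.
rewrite (tnth_nth k) /= nth_flatten.
set b := reshape_index _ _ in rm *.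
have bE : nth [::] ss b = enum (component_indices Y (Ordinal rm)).
  rewrite (nth_map (Ordinal rm)) ?size_enum_ord //.
  by rewrite (nth_ord_enum (Ordinal rm) (Ordinal rm)).
rewrite bE -mem_enum; apply: mem_nth; rewrite -bE.
by move: (reshape_offsetP ks); rewrite (nth_map [::]) // size_map size_enum_ord.
Qed.
End ConnectedComponents.

(** This makes the whole partial normalization an instance of the construction over an open [O]. The
    opens [A] and [omeet A otop] have the same points but are formally different, hence the
    transport along restrictions. *)
Lemma spectral_datum_restrict_otop (R : realType) (X : curve R) (K : line_bundle X) (n : nat)
    (alpha : 'I_n -> K (otop X)) (Q : set (spectral_curve alpha))
    (L : sheaf (partial_normalization Q)) (E : higgs K) :
  spectral_datum E (pushforward (pn_nu Q) L) ->
  spectral_datum E (pushforward (pn_nu Q) (restrict_open L (otop _))).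
Proof.
move=> [h hi hphi].
pose G := pushforward (spectral_pi alpha) (pushforward (pn_nu Q) (restrict_open L (otop _))).
have sub (A : opens (partial_normalization Q)) : omeet A (otop _) `<=` A by move=> z [].
have sup (A : opens (partial_normalization Q)) : A `<=` omeet A (otop _) by move=> z.
pose pre U := opre (pn_nu Q) (opre (spectral_pi alpha) U).
pose f U (s : E U) : G U := res L (sub (pre U)) (h U s).
unshelve eexists (@Hom _ _ E G f _ _ _).
- by move=> U s t; rewrite /f homD; exact: (@resD _ _ L (pre U) _ (sub (pre U)) (h U s) (h U t)).
- move=> U c s hc; rewrite /f hom_act //.
  apply: (@res_act _ _ L (pre U) _ (sub (pre U)) (c \o pn_base (Q := Q)) (h U s)).
  by apply: (@pn_regular_base _ _ _ _ _ _ (pre U) c) => z; exact: hc.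
- move=> U V VU s; rewrite /f hom_res /G /=.
  have hVU : pre V `<=` pre U by move=> z; exact: VU.
  have hm : omeet (pre V) (otop _) `<=` pre U by move=> z [] /hVU.
  by etransitivity; [apply: (res_comp _ _ hm)|apply/esym; apply: res_comp].
- move=> U /=; have [g hg gh] := hi U; exists (fun t => g (res L (sup (pre U)) t)).
    by move=> s; rewrite /f (res_comp _ _ (@subset_refl _ _)) res_id.
  by move=> t; rewrite /f gh (res_comp _ _ (@subset_refl _ _)) res_id.
- move=> U k s hk; rewrite /= /f hphi //; apply: (@res_act _ _ L (pre U) _ (sub (pre U))
    (fun z => tautological k (sub_incl (pn_img z))) (h U s)).
  by apply: (pn_tautological_reg (U := U)) => // z.
Qed.

Lemma pullback_locally_free (R : realType) (X : curve R) (K : line_bundle X) (n : nat)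
    (alpha : 'I_n -> K (otop X)) (Q : set (spectral_curve alpha))
    (L : sheaf (partial_normalization Q)) j (N : sheaf X) r :
  locally_free L r -> pullback (component_incl Q j) L N -> locally_free N r.
Proof.
move=> hL pb p; have [B [Bp [e he]]] := hL (component Q j p).
exists (opre (component_incl Q j) B); split=> //.
by exists (fun i => pb B (e i)); exact: pb_frame.
Qed.

(** * The reduction over the whole curve and the filtration over one connected component *)

Theorem proposition3p12 (R : realType) (X : curve R) (K : line_bundle X)
    (hK : is_canonical K)
    (n : nat) (alpha : 'I_n -> K (otop X)) (hv : in_Vnod alpha)
    (* Q is the subdivisor R of D *)
    (Q : set (spectral_curve alpha)) (hQ : Q `<=` nodes alpha)
    (nR : nat) (Y : 'I_nR -> opens (partial_normalization Q)) (hY : enum_components Y)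
    (* d j is the degree on the component of index j *)
    (d : 'I_n -> int)
    (hd : forall i, \sum_(j in component_indices Y i) d j = (#|` fset_set (component_nodes Y i)|)%:Z) :
  (separating_part Y !=set0 ->
    forall (L : sheaf (partial_normalization Q)) (N : 'I_n -> sheaf X),
      locally_free L 1 ->
      (forall j, inhabited (pullback (component_incl Q j) L (N j))) ->
      (forall j, has_degree (N j) 1 (d j)) ->
    forall E : higgs K,
      hitchin_fibre alpha E ->
      spectral_datum E (pushforward (pn_nu Q) L) ->
      let sh := [seq #|component_indices Y i| | i <- enum 'I_nR] in
      reduction n E (borel_prod sh) (borel_lie sh))
  /\
  (forall (L : sheaf (partial_normalization Q)) (N : 'I_n -> sheaf X),
      locally_free L 1 ->
      (forall j, inhabited (pullback (component_incl Q j) L (N j))) ->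
      (forall j, has_degree (N j) 1 (d j)) ->
    forall (E : higgs K) (Ek : 'I_nR -> higgs K),
      hitchin_fibre alpha E ->
      spectral_datum E (pushforward (pn_nu Q) L) ->
      direct_sum E Ek ->
      (forall k, spectral_datum (Ek k)
         (pushforward (pn_nu Q) (restrict_open L (Y k)))) ->
    forall (k : 'I_nR) (J : (#|component_indices Y k|).-tuple 'I_n),
      perm_eq J (enum (component_indices Y k)) ->
      exists F : nat -> subhiggs (Ek k),
        adapted_filtration Q N J F /\
        (forall G : nat -> subhiggs (Ek k), adapted_filtration Q N J G ->
           forall i, (i <= #|component_indices Y k|)%N ->
           forall (U : opens X) (s : Ek k U), G i U s <-> F i U s)).
Proof.
have pull L (N : 'I_n -> sheaf X) :
    (forall j, inhabited (pullback (component_incl Q j) L (N j))) ->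
    forall j, pullback (component_incl Q j) L (N j).
  move=> h j; have ex : exists _ : pullback (component_incl Q j) L (N j), True.
    by have [pb] := h j; exists pb.
  exact: projT1 (cid ex).
split=> [_ L N hL /pull pb _ E _ /spectral_datum_restrict_otop[theta theta_iso theta_phi] sh|].
  pose J := component_order hY.
  have hJ j p : otop _ (component Q j p) <-> j \in J.
    by split=> // _; rewrite (perm_mem (components_perm hY)) mem_enum.
  have uJ : uniq J by rewrite (perm_uniq (components_perm hY)) enum_uniq.
  have below_le i j : block_le sh i j -> (i <= j)%N by move=> /andP[].
  (* Components that meet lie in one connected component, hence in one block. *)
  have below_meet (i j : 'I_n) p : (i <= j)%N ->
      component Q (tnth J i) p = component Q (tnth J j) p -> block_le sh i j.
    move=> ij e; rewrite /block_le ij andbT /sh.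
    have [b [-> ib]] := component_orderP hY i; have [b' [-> jb']] := component_orderP hY j.
    by apply/eqP; congr (nat_of_ord _); exact: component_indices_inj ib jb' e.
  apply: (flag_reduction (rho := rho pb hJ theta) (a := fun i => alpha (tnth J i))
    (D := later_nodes Q J)).
  - by move=> U s; exact: rho_inj.
  - by move=> i U k c s; exact: rho_phi.
  - by move=> p; exact: spectral_flag_local.
move=> L N hL /pull pb _ E Ek _ _ _ hEk k J JC; have [theta theta_iso theta_phi] := hEk k.
have hJ j p : Y k (component Q j p) <-> j \in J.
  by rewrite (perm_mem JC) mem_enum; exact: component_indicesE.
have uJ : uniq J by rewrite (perm_uniq JC) enum_uniq.
set r := #|component_indices Y k| in J JC hJ uJ *.
(* Here [O] is a single connected component, so there are no blocks and the plain order is taken. *)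
pose below : rel 'I_r := fun i j => (i <= j)%N.
have below_le i j : below i j -> (i <= j)%N by [].
have rinj U (s : Ek k U) : (forall i, rho pb hJ theta i U s = 0) -> s = 0 by exact: rho_inj.
have rphi i U (kk : K U) c (s : Ek k U) : frame1 kk -> coefficient kk (alpha (tnth J i)) c ->
    rho pb hJ theta i U (phi kk s) = act (N (tnth J i)) c (rho pb hJ theta i U s).
  exact: rho_phi.
have floc p : exists V : opens X, V p /\ exists e : 'I_r -> Ek k V,
    forall i, flag_section (rho pb hJ theta) (later_nodes Q J) below i (e i).
  by apply: spectral_flag_local.
pose F := flag rphi.
have gF : graded (fun i => N (tnth J i)) (later_nodes Q J) (fun i => alpha (tnth J i)) F.
  by move=> i; exact: flag_quotient below_le rphi floc i.
have F0 U (s : Ek k U) : F 0%N U s <-> s = 0 by exact: flag_bot.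
have Fr U (s : Ek k U) : F r U s by exact: flag_top.
exists F; split.
  split=> // i; split; [|exact: (flag_free below_le rinj rphi floc)|exact: gF].
  exact: flag_strict below_le rphi floc i.
(* The canonical choice is expressed as uniqueness: the graded pieces alone determine every step. *)
move=> G [G0 Gr Gi] i ir U s.
apply: (@graded_unique _ _ _ _ _ (fun i => N (tnth J i)) (later_nodes Q J)
  (fun i => alpha (tnth J i)) _ _ F G) => //.
- by move=> l; exact: pullback_locally_free hL (pb _).
- move=> l l' V kk c c' p ll'; apply: coefficient_diff_near => //.
  by rewrite (inj_eq (tuple_uniqP _ uJ)).
- by move=> l; have [_ _ h] := Gi l.
- by move=> V t /F0.
- by move=> V t /G0.
Qed.
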